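(* Let $A\equiv A(\mu):\mathcal{H}\to L^2(\Omega)$, $\mathcal{W}=\mathcal{R}(A)\hookrightarrow L^2(\Omega)$, the centers $\Xi_N=\{\xi_1,\dots,\xi_N\}\subset\Omega$, the subspaces $H_N=\mathrm{span}\{\mathfrak{K}_{\xi_1},\dots,\mathfrak{K}_{\xi_N}\}\subset\mathcal{N}(A)^\perp$ and $Y_N=\mathrm{span}\{A\mathfrak{K}_{\xi_1},\dots,A\mathfrak{K}_{\xi_N}\}$ be as in the context, for $N\ge N_0$. Let $b\in\mathcal{W}$, $b^\delta\in L^2(\Omega)$, put $\delta=\|b-b^\delta\|_{L^2(\Omega)}$, and let $v_N^\delta=G_Nb^\delta\in H_N$ be the Galerkin approximation (Method (C2)) of the noisy operator equation $Av^\delta=b^\delta\in L^2(\Omega)$, where $G_N=(\Pi_{Y_N}A|_{H_N})^{-1}\Pi_{Y_N}$. Let $v\in\mathcal{H}$ be the solution of the noise-free equation $Av=b$, and assume that $v=L_{\mathfrak{K}}p$ for some $p\in L^2(\Omega)$. Assume that the following Bernstein inequality holds with a rate function $R_I(N)>0$, $R_I(N)\to0$ as $N\to\infty$: there is a constant $c>0$ such that for all $N\ge N_0$ $$\|w_N\|_{\mathcal{W}}\le c\,\frac{1}{R_I(N)}\,\|w_N\|_{L^2(\Omega)}\qquad\text{for all } w_N\in Y_N .$$ If the Galerkin scheme is convergent, then there exist constants $C_I,C_2>0$, independent of $N$ and of $b^\delta$ (hence of $\delta$), such that for all $N\ge N_0$ $$\begin{aligned}\|v-v_N^\delta\|_{L^\infty(\Omega)}&\le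 \|v-v_N^\delta\|_{\mathcal{H}}\\&\le C_I\frac{\delta}{R_I(N)}+C_2\,\sup_{\xi\in\Omega}\sqrt{\mathfrak{K}(\xi,\xi)-\mathfrak{K}_{\Xi_N}^{\mathrm T}(\xi)\mathbb{K}_N^{-1}\mathfrak{K}_{\Xi_N}(\xi)}\;\|L_{\mathfrak{K}}^{-1}v\|_{L^2(\Omega)}\\&= C_I\frac{\delta}{R_I(N)}+C_2\,\sup_{\xi\in\Omega}\mathcal{P}_{H_N}(\xi)\,\|L_{\mathfrak{K}}^{-1}v\|_{L^2(\Omega)},\end{aligned}$$ where $L_{\mathfrak{K}}^{-1}v$ denotes $p$.
   Context: Domain and kernel. $\Omega\subset\mathbb{R}^n$ is compact, simply connected, and equal to the closure of its interior. $\mathfrak{K}:\Omega\times\Omega\to\mathbb{R}$ is a symmetric, strictly positive kernel (Gram matrices of finitely many distinct points are positive definite), bounded on the diagonal, with $\mathfrak{K}\in C^{2s}(\Omega\times\Omega)$ for some integer $s\ge1$ (derivatives on $\Omega$ are continuous extensions from the interior). $\mathcal{H}$ is the reproducing kernel Hilbert space (RKHS) of real-valued functions on $\Omega$ with kernel $\mathfrak{K}$; $\mathfrak{K}_x=\mathfrak{K}(\cdot,x)$. Functions in $\mathcal{H}$ are $C^s$, and $D^{e_k}v(x)=(D^{(e_k,0)}\mathfrak{K}(x,\cdot),v)_{\mathcal{H}}$, where $e_k$ is the $k$-th unit multiindex and $D^{(\alpha,\beta)}\mathfrak{K}(x,y)$ denotes differentiation of order $\alpha$ in $x$ and $\beta$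 in $y$. Operator. $f:\mathbb{R}^n\to\mathbb{R}^n$ and $g:\mathbb{R}^n\to\mathbb{R}^{n\times m}$ are given (dynamics $\dot x=f(x)+g(x)u$), and $\mu:\Omega\to\mathbb{R}^m$ is a fixed feedback law. For $v\in\mathcal{H}$, $$(Av)(x)=(f(x)+g(x)\mu(x))^{\mathrm T}\nabla v(x)=\sum_{k=1}^n a_k(x)D^{e_k}v(x),\qquad a_k=f_k+\sum_{j=1}^m g_{kj}\mu_j.$$ $\mathcal{N}(A)$ and $\mathcal{R}(A)$ are the nullspace and range. $\mathcal{W}=\mathcal{R}(A)$ is normed by $\|w\|_{\mathcal{W}}=\inf\{\|h\|_{\mathcal{H}}: Ah=w\}$; it is the RKHS with kernel $\mathfrak{w}(x,y)=\sum_{k,\ell=1}^n a_k(x)D^{(e_k,e_\ell)}\mathfrak{K}(x,y)a_\ell(y)$. It is taken as standing that $\mathcal{W}$ is continuously embedded in $C(\Omega)$, hence in $L^2(\Omega)$, so that $A$ may be viewed as a bounded operator $\mathcal{H}\to L^2(\Omega)$. Galerkin scheme. For each $N\ge N_0$, $\Xi_N=\{\xi_1,\dots,\xi_N\}\subset\Omega$ is a set of $N$ distinct centers. $\Pi_{Y_N}$ is the $L^2(\Omega)$-orthogonal projection onto $Y_N$, and $G_N=(\Pi_{Y_N}A|_{H_N})^{-1}\Pi_{Y_N}:L^2(\Omega)\to H_N$. The scheme is convergent if $G_N$ is well-defined for every $N\ge N_0$ and, for every $y\in\mathcal{R}(A)$, $G_Ny\to(A|_{\mathcal{N}(A)^\perp})^{-1}y$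 in $\mathcal{H}$ as $N\to\infty$. Other notation. $(L_{\mathfrak{K}}p)(x)=\int_\Omega\mathfrak{K}(x,y)p(y)\,dy$ for $p\in L^2(\Omega)$. $\mathfrak{K}_{\Xi_N}(x)=[\mathfrak{K}_{\xi_1}(x),\dots,\mathfrak{K}_{\xi_N}(x)]^{\mathrm T}\in\mathbb{R}^N$, $\mathbb{K}_N=[\mathfrak{K}(\xi_i,\xi_j)]\in\mathbb{R}^{N\times N}$, and the power function of $H_N$ in $\mathcal{H}$ is $\mathcal{P}_{H_N}(x)=\sqrt{\mathfrak{K}(x,x)-\mathfrak{K}_{\Xi_N}^{\mathrm T}(x)\mathbb{K}_N^{-1}\mathfrak{K}_{\Xi_N}(x)}$.
   Formalization: The first inequality fails when the kernel exceeds 1 on the diagonal (scale K by a large constant); it is replaced by L^∞ norm ≤ κ times the H-norm, where K(x,x) ≤ κ² on Ω; κ = 1 gives the printed chain, and the final bound on the L^∞ norm is kept for every κ. *)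

(* Defs.v *)
From HB Require Import structures.
From mathcomp Require Import all_boot all_order all_algebra.
From mathcomp Require Import all_classical all_reals all_analysis.

Set Implicit Arguments.
Unset Strict Implicit.
Unset Printing Implicit Defensive.
Import Order.TTheory GRing.Theory Num.Theory.
Import numFieldNormedType.Exports.
Local Open Scope classical_set_scope.
Local Open Scope ring_scope.

(* The n-fold product sigma-algebra on R^n, that is the Borel sets. *)

Definition measure_rV_display : measure_display.
Proof. exact. Qed.

Section measurable_rV.
Context (R : realType) (n : nat).

Let coord : 'I_n -> 'rV[R]_n -> measurableTypeR R := fun i x => x ord0 i.

Let rV_set0 : g_sigma_preimage coord set0.
Proof. exact: sigma_algebra0. Qed.

Let rV_setC A : g_sigma_preimage coord A -> g_sigma_preimage coord (~` A).
Proof. exact: sigma_algebraC. Qed.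

Let rV_bigcup (F : (set 'rV[R]_n)^nat) :
  (forall i, g_sigma_preimage coord (F i)) ->
  g_sigma_preimage coord (\bigcup_i (F i)).
Proof. exact: sigma_algebra_bigcup. Qed.

HB.instance Definition _ := @isMeasurable.Build measure_rV_display
  'rV[R]_n (g_sigma_preimage coord) rV_set0 rV_setC rV_bigcup.

Lemma measurable_rV_coord (i : 'I_n) :
  measurable_fun [set: 'rV[R]_n] (fun x => x ord0 i : measurableTypeR R).
Proof.
move=> _ Y mY; rewrite setTI; apply: sub_sigma_algebra => /=.
rewrite -bigcup_seq/=; exists i => /=; first by rewrite mem_index_enum.
by exists Y => //; rewrite setTI.
Qed.

Lemma measurable_fun_rV d (T : measurableType d) (f : T -> 'rV[R]_n) :
  (forall i, measurable_fun [set: T] (fun t => f t ord0 i : measurableTypeR R)) ->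
  measurable_fun [set: T] f.
Proof.
move=> mf _ A mA.
suff: g_sigma_preimage coord `<=`
    (fun B => measurable ([set: T] `&` f @^-1` B)) by apply.
apply: smallest_sub => [|B].
  split => /=.
  - by rewrite preimage_set0 setI0.
  - by move=> B; rewrite /= setTD preimage_setC !setTI; exact: measurableC.
  - move=> F mF; rewrite preimage_bigcup setI_bigcupr.
    exact: bigcup_measurable.
rewrite -bigcup_seq/= => -[i _ [C mC <-]].
by rewrite setTI -comp_preimage; exact: mf.
Qed.

End measurable_rV.

Section lebesgue_rV.
Context (R : realType).

Definition row_snoc n (p : 'rV[R]_n * measurableTypeR R) : 'rV[R]_n.+1 :=
  \row_i if unlift ord_max i is Some j then p.1 ord0 j else p.2.

Lemma measurable_row_snoc n :
  measurable_fun [set: 'rV[R]_n * measurableTypeR R] (@row_snoc n).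
Proof.
apply: measurable_fun_rV => i.
under eq_fun do rewrite mxE.
case: (unliftP ord_max i) => [j _|_]; last exact: measurable_snd.
exact: (measurableT_comp (measurable_rV_coord j) measurable_fst).
Qed.

Section lebesgue_step.
Variables (n : nat) (mu : {measure set 'rV[R]_n -> \bar R}).

Definition lebesgue_step : set 'rV[R]_n.+1 -> \bar R :=
  pushforward (mu \x @lebesgue_measure R)%E (@row_snoc n).

Let msnoc := @measurable_row_snoc n.

Let step0 : lebesgue_step set0 = 0%E.
Proof. by rewrite /lebesgue_step /pushforward preimage_set0 measure0. Qed.

Let step_ge0 A : (0 <= lebesgue_step A)%E.
Proof. exact: integral_ge0. Qed.

Let step_sigma_additive : semi_sigma_additive lebesgue_step.
Proof.
exact: (@measure_semi_sigma_additive _ _ _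
  (measure_function_pushforward__canonical__measure_function_Measure _ msnoc)).
Qed.

HB.instance Definition _ := isMeasure.Build _ _ _ lebesgue_step
  step0 step_ge0 step_sigma_additive.

End lebesgue_step.

Fixpoint lebesgue_rV n : {measure set 'rV[R]_n -> \bar R} :=
  if n is p.+1 then lebesgue_step (lebesgue_rV p) else \d_(0 : 'rV[R]_0).

End lebesgue_rV.

Lemma lebesgue_rV_box (R : realType) n (A : 'I_n -> set (measurableTypeR R)) :
  (forall i, measurable (A i)) ->
  lebesgue_rV R n [set x | forall i, A i (x ord0 i)] =
  (\prod_(i < n) lebesgue_measure (A i))%E.
Proof.
elim: n A => [|n IH] A mA.
  by rewrite big_ord0 /= diracE mem_set// => -[].
rewrite big_ord_recr/= -IH//.
rewrite -product_measure1E//; last first.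
  rewrite [X in measurable X](_ : _ =
    \bigcap_(i in [set: 'I_n]) ((fun x : 'rV[R]_n => x ord0 i) @^-1`
      A (widen_ord (leqnSn n) i))); last first.
    by apply/seteqP; split=> x /=; [move=> h i _; exact: h|move=> h i; exact: h].
  apply: fin_bigcap_measurable => // i _.
  by rewrite -[X in measurable X]setTI; exact: measurable_rV_coord.
rewrite /lebesgue_step /pushforward; congr (_ _).
apply/seteqP; split=> -[x t] /=.
  move=> h; split.
    move=> i; have := h (widen_ord (leqnSn n) i).
    rewrite mxE (_ : widen_ord _ i = lift ord_max i) ?liftK//.
    by apply/val_inj => /=; rewrite /bump leqNgt ltn_ord.
  by have := h ord_max; rewrite mxE unlift_none.
move=> [hx ht] i; rewrite mxE; case: (unliftP ord_max i) => [j ->|->] //.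
rewrite (_ : lift ord_max j = widen_ord (leqnSn n) j) ?liftK//.
by apply/val_inj => /=; rewrite /bump leqNgt ltn_ord.
Qed.

(* [C^k] on the closure [D] of an open set: the iterated partial derivatives
   along the directions [e], which exist in the interior of [D], extend
   continuously to [D]. *)
Fixpoint Ck_on (R : realType) (V : normedModType R) (I : Type) (e : I -> V)
    (D : set V) (k : nat) (f : V -> R) : Prop :=
  {within D, continuous f} /\
  if k is k'.+1 then
    forall i, exists2 g : V -> R, Ck_on e D k' g &
      forall x, interior D x -> is_derive x (e i) f (g x)
  else True.

Definition path_in (R : realType) (V : topologicalType) (D : set V)
    (p : R -> V) : Prop :=
  {within `[0, 1], continuous p} /\ forall t, t \in `[0, 1] -> D (p t).

Definition simply_connected (R : realType) (V : topologicalType) (D : set V) :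
    Prop :=
  [/\ D !=set0,
      (forall x y, D x -> D y ->
         exists p : R -> V, [/\ path_in D p, p 0 = x & p 1 = y])
    & (forall p : R -> V, path_in D p -> p 0 = p 1 ->
         exists h : R * R -> V,
         [/\ {within `[0, 1] `*` `[0, 1], continuous h},
             (forall s t, s \in `[0, 1] -> t \in `[0, 1] -> D (h (s, t))),
             (forall t, t \in `[0, 1] -> h (0, t) = p t /\ h (1, t) = p 0)
           & (forall s, s \in `[0, 1] -> h (s, 0) = p 0 /\ h (s, 1) = p 0)])].

(* Functions on [Om] are represented by functions on the whole of R^n whose
   values outside [Om] are either irrelevant or 0. *)
Section kernels.
Context (R : realType) (n : nat).
Local Notation E := 'rV[R]_n.
Implicit Types (Om : set E) (K : E -> E -> R).

Definition Ck_kernel Om k K : Prop :=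
  Ck_on (fun i : 'I_n + 'I_n => match i with
                                | inl j => (delta_mx ord0 j, 0)
                                | inr j => (0, delta_mx ord0 j)
                                end : E * E)
    (Om `*` Om) k (fun z => K z.1 z.2).

Definition gram_mx K N (xi : 'I_N -> E) : 'M[R]_N :=
  \matrix_(i, j) K (xi i) (xi j).

Definition kernel_col K N (xi : 'I_N -> E) (x : E) : 'cV[R]_N :=
  \col_i K x (xi i).

Definition strictly_positive_kernel Om K : Prop :=
  forall N (xi : 'I_N -> E), (forall i, Om (xi i)) -> injective xi ->
  forall c : 'cV[R]_N, c != 0 -> 0 < (c^T *m gram_mx K xi *m c) ord0 ord0.

Definition power_function K N (xi : 'I_N -> E) (x : E) : R :=
  Num.sqrt (K x x - ((kernel_col K xi x)^T *m invmx (gram_mx K xi)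
                       *m kernel_col K xi x) ord0 ord0).

(* The RKHS of functions on [Om] with kernel [K]: a Hilbert space whose
   elements are identified with functions on [Om] through [ev]. *)
Record rkhs Om K := RKHS {
  rkhs_space :> completeNormedModType R ;
  dot : rkhs_space -> rkhs_space -> R ;
  dotC : forall u v, dot u v = dot v u ;
  dotDZl : forall a u v w, dot (a *: u + v) w = a * dot u w + dot v w ;
  dot_norm : forall u, dot u u = `|u| ^+ 2 ;
  ev : rkhs_space -> E -> R ;
  evDZ : forall a u v x, Om x -> ev (a *: u + v) x = a * ev u x + ev v x ;
  ev_inj : forall u v, (forall x, Om x -> ev u x = ev v x) -> u = v ;
  ksec : E -> rkhs_space ;
  ev_ksec : forall x y, Om x -> Om y -> ev (ksec x) y = K y x ;
  reproducing : forall u x, Om x -> dot u (ksec x) = ev u x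
}.

End kernels.

Section L2.
Context (R : realType) (n : nat) (Om : set 'rV[R]_n).
Local Notation E := 'rV[R]_n.
Local Notation leb := (lebesgue_rV R n).

Definition inL2 (f : E -> R) : Prop := (f \_ Om) \in Lfun leb 2%:E.

Definition normL2 (f : E -> R) : R := fine ('N[leb]_(2%:E) [EFin \o (f \_ Om)])%E.

Definition dotL2 (f g : E -> R) : R := \int[leb]_(x in Om) (f x * g x).

Definition normLoo (f : E -> R) : \bar R := ('N[leb]_+oo [EFin \o (f \_ Om)])%E.

(* The orthogonal projection onto [Y]. It is determined only up to a null set
   in general; below, [Y] consists of functions that are continuous on [Om] and
   0 outside, for which almost everywhere equality is equality. *)
Definition projL2 (Y : set (E -> R)) (y : E -> R) : E -> R :=
  get [set w | Y w /\ forall z, Y z -> dotL2 (fun x => y x - w x) z = 0].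

Definition integral_op (K : E -> E -> R) (p : E -> R) (x : E) : R :=
  \int[leb]_(y in Om) (K x y * p y).

(* The partial derivative on [Om], extended from the interior by continuity. *)
Definition partial (k : 'I_n) (f : E -> R) (x : E) : R :=
  lim ('D_(delta_mx ord0 k) f y @[y --> within (interior Om) (nbhs x)]).

End L2.

Definition lincomb (R : realType) (V : lmodType R) N (e : 'I_N -> V) : set V :=
  [set v | exists c : 'I_N -> R, v = \sum_(i < N) c i *: e i].

Section galerkin.
Context (R : realType) (n m : nat) (Om : set 'rV[R]_n).
Context (K : 'rV[R]_n -> 'rV[R]_n -> R) (H : rkhs Om K).
Context (f : 'rV[R]_n -> 'cV[R]_n) (g : 'rV[R]_n -> 'M[R]_(n, m)).
Context (mu : 'rV[R]_n -> 'cV[R]_m).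
Local Notation E := 'rV[R]_n.

(* States are row vectors; the vector fields have column vectors as values. *)
Definition Aop (v : H) : E -> R :=
  (fun x => \sum_(k < n) (f x + g x *m mu x) k ord0 * partial Om k (ev v) x)
  \_ Om.

Definition kerA : set H := [set u | Aop u = cst 0].

Definition kerA_perp : set H := [set u | forall w, kerA w -> dot u w = 0].

Definition rangeA : set (E -> R) := range Aop.

Definition normW (w : E -> R) : R :=
  inf [set `|h| | h in [set h : H | Aop h = w]].

Definition embedW : Prop :=
  (forall w, rangeA w -> {within Om, continuous w}) /\
  exists C, forall w, rangeA w -> forall x, Om x -> `|w x| <= C * normW w.

(* [(A|_{N(A)^perp})^{-1}], total, meaningful on the range of [A]. *)
Definition Apinv (y : E -> R) : H := get [set h | kerA_perp h /\ Aop h = y].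

Section centers.
Context N (xi : 'I_N -> E).

Definition HN : set H := lincomb (fun i => ksec H (xi i)).

Definition YN : set (E -> R) := lincomb (fun i => Aop (ksec H (xi i)) : E -> R^o).

(* Invertibility of the operator from [HN] to [YN] obtained by projecting [A]. *)
Definition GN_defined : Prop :=
  set_bij HN YN (fun h => projL2 Om YN (Aop h)).

Definition GN (y : E -> R) : H :=
  get [set h | HN h /\ projL2 Om YN (Aop h) = projL2 Om YN y].

End centers.

Definition galerkin_convergent (N0 : nat) (xi : forall N, 'I_N -> E) : Prop :=
  (forall N, (N0 <= N)%N -> GN_defined (xi N)) /\
  forall y, rangeA y -> (fun N => GN (xi N) y) @ \oo --> Apinv y.

End galerkin.

Arguments kerA {R n m Om K} H f g mu _.
Arguments kerA_perp {R n m Om K} H f g mu _.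
Arguments rangeA {R n m Om K} H f g mu _.
Arguments normW {R n m Om K} H f g mu w.
Arguments embedW {R n m Om K} H f g mu.
Arguments Apinv {R n m Om K} H f g mu y.
Arguments HN {R n Om K} H {N} xi _.
Arguments YN {R n m Om K} H f g mu {N} xi _.
Arguments GN_defined {R n m Om K} H f g mu {N} xi.
Arguments GN {R n m Om K} H f g mu {N} xi y.
Arguments galerkin_convergent {R n m Om K} H f g mu N0 xi.
Arguments simply_connected R {V} D.

(* Main.v *)
(* Write T_N = G_N A. On H_N, which is orthogonal to N(A), the operator A is an
   isometry onto its image with the norm of W, so the Bernstein inequality gives
   |h| <= c / R_I(N) |A h|_{L^2} for h in H_N. Hence the Gram matrix of the
   functions A K_{xi_i} in L^2 is invertible, Galerkin solutions are unique,
   |G_N y| <= c / R_I(N) |y|_{L^2}, and T_N is a projection onto H_N. Convergence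
   of the scheme and the Banach-Steinhaus theorem bound the T_N uniformly, so
   v - v_N^delta = (I - T_N)(v - P_N v) + G_N (b - b^delta), with P_N the
   orthogonal projection onto H_N, is estimated by |v - P_N v| and delta. The
   source condition gives <v, u> = int p u for all u in H, since both sides are
   bounded functionals of u that agree on the total family K_x. As
   |(v - P_N v)(x)| <= P_{H_N}(x) |v - P_N v|, taking u = v - P_N v bounds
   |v - P_N v| by the supremum of the power function times |p|_{L^2}.
   Linearity of A requires the functions of H to have partial derivatives on the
   interior that extend continuously: difference quotients of the sections K_y
   form a Cauchy family in H because their inner products are mixed second
   difference quotients of K. *)

Require Import Defs.
From mathcomp Require Import all_boot all_order all_algebra.
From mathcomp Require Import all_classical all_reals all_analysis.
From mathcomp Require Import measurable_realfun ess_sup_inf.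
From mathcomp Require Import ring lra.
Set Implicit Arguments.
Unset Strict Implicit.
Unset Printing Implicit Defensive.
Import Order.TTheory GRing.Theory Num.Theory.
Import numFieldNormedType.Exports.
Local Open Scope classical_set_scope.
Local Open Scope ring_scope.

(** * Differentiability in the reproducing kernel Hilbert space *)

(** A Cauchy criterion that names no candidate limit; it serves difference quotients, derivatives
    restricted to the interior, and minimizing families alike. *)
Lemma cvg_cauchy_pairs (R : realType) (V : completeNormedModType R) (T : Type)
    (F : set_system T) (FF : ProperFilter F) (f : T -> V) :
  (forall eps, 0 < eps -> exists2 P, F P &
     forall s t, P s -> P t -> `|f s - f t| <= eps) -> cvg (f @ F).
Proof.
move=> fP; apply/cauchy_cvgP; apply: cauchy_exP => eps e0.
have e2 : 0 < eps / 2 by rewrite divr_gt0.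
have [P FP fe] := fP _ e2.
have [s Ps] := filter_ex FP.
exists (f s); apply: (@filterS _ F _ P) => // t Pt.
rewrite /preimage /= -ball_normE /=.
by apply: le_lt_trans (fe _ _ Ps Pt) _; rewrite ltr_pdivrMr// ltr_pMr// ltr1n.
Qed.

(** The step [h] may have either sign, so the mean value theorem is applied on [0, h] or on [h, 0];
    the bound [|s| <= |h|] covers both. *)
Lemma normr_MVT (R : realType) (f df : R -> R) (h : R) :
  (forall s : R, `|s| <= `|h| -> is_derive s 1 f (df s)) ->
  exists2 s, `|s| <= `|h| & f h - f 0 = df s * h.
Proof.
move=> fd.
have cf a b : (forall s, s \in `[a, b] -> `|s| <= `|h|) ->
    {within `[a, b], continuous f}.
  move=> ab; apply: derivable_within_continuous => x xab.
  by have [] := fd x (ab _ xab).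
have [h0|h0] := leP 0 h.
  have ab s : s \in `[0, h] -> `|s| <= `|h|.
    by rewrite in_itv/= => /andP[s0 sh]; rewrite !ger0_norm.
  have := @MVT_segment R f df 0 h h0 _ (cf _ _ ab).
  case=> [x /subset_itv_oo_cc /ab /fd//|c /ab ch ->].
  by exists c => //; rewrite subr0.
have ab s : s \in `[h, 0] -> `|s| <= `|h|.
  by rewrite in_itv/= => /andP[s0 sh]; rewrite !ler0_norm ?lerN2// ltW.
have := @MVT_segment R f df h 0 (ltW h0) _ (cf _ _ ab).
case=> [x /subset_itv_oo_cc /ab /fd//|c /ab ch E].
by exists c => //; rewrite -opprB E; ring.
Qed.

(** The two difference quotients are the same function of the increment, so directional derivatives
    suffice and no chain rule enters. *)
Lemma is_derive_line (R : realType) (V : normedModType R) (f : V -> R)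
    (x v : V) (t d : R) :
  is_derive (x + t *: v) v f d -> is_derive t 1 (fun s : R => f (x + s *: v)) d.
Proof.
move=> [fd fE].
have E : (fun h : R => h^-1 *: (((fun s => f (x + s *: v)) \o shift t) (h *: 1) -
            f (x + t *: v))) =
         (fun h : R => h^-1 *: ((f \o shift (x + t *: v)) (h *: v) -
            f (x + t *: v))).
  apply/funext => h /=; congr (_ *: (f _ - _)).
  by rewrite [h *: 1]mulr1 scalerDl addrCA.
split; first by rewrite /derivable E.
by rewrite -fE /derive E.
Qed.

(** * Mixed second difference quotients of a kernel *)

Section mixed.
Context (R : realType) (E : normedModType R) (D : set E) (e : E).
Context (K : E -> E -> R) (G1 G2 : E * E -> R).
Hypothesis dK : forall z, interior (D `*` D) z ->
  is_derive z (e, 0 : E) (fun z => K z.1 z.2) (G1 z).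
Hypothesis dG1 : forall z, interior (D `*` D) z ->
  is_derive z (0 : E, e) G1 (G2 z).
Hypothesis cG2 : {within D `*` D, continuous G2}.

Let DD y z : interior D y -> interior D z -> interior (D `*` D) (y, z).
Proof. by move=> Dy Dz; exists (D, D). Qed.

(** The mean value theorem is applied twice: in the first argument to [K(., z + k e) - K(., z)],
    then in the second argument to [G1(y + s e, .)]. *)
Lemma mixed_MVT (y z : E) (h k : R) :
  (forall s : R, `|s| <= `|h| -> interior D (y + s *: e)) ->
  (forall s : R, `|s| <= `|k| -> interior D (z + s *: e)) ->
  exists s t, [/\ `|s| <= `|h|, `|t| <= `|k| &
    K (y + h *: e) (z + k *: e) - K y (z + k *: e)
    - (K (y + h *: e) z - K y z) = h * k * G2 (y + s *: e, z + t *: e)].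
Proof.
move=> yh zk.
have z0 : interior D z by have := zk 0; rewrite scale0r addr0 normr0; exact.
have Kd w (s : R) : interior D w -> `|s| <= `|h| ->
    is_derive s 1 (fun s : R => K (y + s *: e) w) (G1 (y + s *: e, w)).
  move=> Dw /yh Dy.
  pose F := fun z : E * E => K z.1 z.2.
  rewrite (_ : (fun s : R => _) = (fun s => F ((y, w) + s *: (e, 0)))).
    apply: is_derive_line; rewrite (_ : (y, w) + _ = (y + s *: e, w)).
      exact/dK/DD.
    by congr (_, _); rewrite /= scaler0 addr0.
  by apply/funext => t; rewrite /F /= scaler0 addr0.
have := @normr_MVT R
  (fun s : R => K (y + s *: e) (z + k *: e) - K (y + s *: e) z)
  (fun s : R => G1 (y + s *: e, z + k *: e) - G1 (y + s *: e, z)) h.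
case=> [s sh|s sh].
  by apply: is_deriveB; apply: Kd => //; exact: zk.
rewrite scale0r addr0 => E1.
have := @normr_MVT R (fun t : R => G1 (y + s *: e, z + t *: e))
  (fun t : R => G2 (y + s *: e, z + t *: e)) k.
case=> [t tk|t tk].
  rewrite (_ : (fun t : R => _) =
    (fun t => G1 ((y + s *: e, z) + t *: ((0, e) : E * E)))).
    apply: is_derive_line.
    rewrite (_ : (y + s *: e, z) + _ = (y + s *: e, z + t *: e)).
      by apply/dG1/DD; [exact: yh|exact: zk].
    by congr (_, _); rewrite /= scaler0 addr0.
  apply/funext => t'; congr G1.
  by congr (_, _); rewrite /= scaler0 addr0.
rewrite scale0r addr0 => E2.
exists s, t; split => //.
by rewrite [h * k]mulrC mulrAC [k * _]mulrC -E2 -E1; ring.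
Qed.

(* The pair (y, h) is admissible: the difference quotient at y with step h only
   involves points of the interior of D at distance less than d from x. *)
Definition step_in (x : E) (d : R) (y : E) (h : R) :=
  h != 0 /\
  forall s : R, `|s| <= `|h| -> ball x d (y + s *: e) /\ interior D (y + s *: e).

(** By [mixed_MVT] the quotient is a value of [G2] near (x, x). Only continuity of [G2] relative to
    [D * D] enters at that point, so [x] may lie on the boundary. *)
Lemma mixed_quotient_cvg x eps : D x -> 0 < eps ->
  exists2 d, 0 < d & forall y z h k, step_in x d y h -> step_in x d z k ->
  `| (h * k)^-1 * (K (y + h *: e) (z + k *: e) - K y (z + k *: e)
    - (K (y + h *: e) z - K y z)) - G2 (x, x) | <= eps.
Proof.
move=> Dx e0.
have Dxx : (D `*` D) (x, x) by [].
have /cvgrPdist_le/(_ _ e0) := @cG2 (x, x).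
rewrite /nbhs /= /nbhs_subspace mem_set//=.
move=> /nbhs_ballP[d /= d0 Hd].
exists d => // y z h k [h0 Hy] [k0 Hz].
have [||s [t [sh tk ->]]] := @mixed_MVT y z h k.
  by move=> s /Hy[].
  by move=> s /Hz[].
rewrite mulKf ?mulf_neq0// distrC.
have [bs /interior_subset Ds] := Hy _ sh.
have [bt /interior_subset Dt] := Hz _ tk.
exact: (Hd (y + s *: e, z + t *: e)).
Qed.

Lemma step_in_near x d y : 0 < d -> ball x d y -> interior D y ->
  \forall h \near 0^', step_in x d y h.
Proof.
move=> d0 xy Dy.
have : nbhs y (ball x d `&` interior D).
  apply: filterI; last by apply: open_nbhs_nbhs; split => //; exact: open_interior.
  by apply: open_nbhs_nbhs; split => //; exact: ball_open.
move=> /nbhs_ballP[r /= r0 Hr].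
(* The added 1 keeps the divisor positive when [e] is zero. *)
have e1 : 0 < `|e| + 1 by rewrite ltr_wpDl.
near=> h; split; first by near: h; exact: nbhs_dnbhs_neq.
move=> s sh; apply: Hr; rewrite -ball_normE /= opprD addNKr normrN normrZ.
rewrite (le_lt_trans (y := `|h| * (`|e| + 1)))//.
  by rewrite ler_pM// ler_wpDr.
rewrite -ltr_pdivlMr//; near: h.
by apply: dnbhs0_lt; rewrite divr_gt0.
Unshelve. all: by end_near. Qed.
End mixed.

(** * The inner product of the reproducing kernel Hilbert space *)

Section rkhs_dot.
Context (R : realType) (n : nat) (Om : set 'rV[R]_n).
Context (K : 'rV[R]_n -> 'rV[R]_n -> R) (H : rkhs Om K).
Implicit Types u v w : H.

Lemma dotDl u v w : dot (u + v) w = dot u w + dot v w.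
Proof. by rewrite -[u]scale1r dotDZl scale1r mul1r. Qed.

Lemma dot0l w : dot 0 w = 0.
Proof. by apply: (@addrI _ (dot 0 w)); rewrite -dotDl !addr0. Qed.

Lemma dotZl a u w : dot (a *: u) w = a * dot u w.
Proof. by rewrite -[_ *: u]addr0 dotDZl dot0l addr0. Qed.

Lemma dotNl u w : dot (- u) w = - dot u w.
Proof. by rewrite -scaleN1r dotZl mulN1r. Qed.

Lemma dotBl u v w : dot (u - v) w = dot u w - dot v w.
Proof. by rewrite dotDl dotNl. Qed.

Lemma dotDr u v w : dot w (u + v) = dot w u + dot w v.
Proof. by rewrite !(dotC w) dotDl. Qed.

Lemma dotZr a u w : dot w (a *: u) = a * dot w u.
Proof. by rewrite !(dotC w) dotZl. Qed.

Lemma dotBr u v w : dot w (u - v) = dot w u - dot w v.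
Proof. by rewrite !(dotC w) dotBl. Qed.

Lemma dot_suml (I : Type) (r : seq I) (P : pred I) (F : I -> H) w :
  dot (\sum_(i <- r | P i) F i) w = \sum_(i <- r | P i) dot (F i) w.
Proof.
apply: (big_morph (fun u => dot u w)) => [u v|]; first exact: dotDl.
exact: dot0l.
Qed.

(** Cauchy-Schwarz: the residual of [u] after projection onto the line of [v] has nonnegative
    square. *)
Lemma normr_dot u v : `|dot u v| <= `|u| * `|v|.
Proof.
have [->|v0] := eqVneq v 0; first by rewrite dotC dot0l !normr0 mulr0.
have nv : 0 < dot v v by rewrite dot_norm exprn_gt0// normr_gt0.
have := sqr_ge0 `|u - (dot u v / dot v v) *: v|.
rewrite -dot_norm dotBl !dotBr !dotZl !dotZr (dotC v u) => h.
rewrite -(@ler_pXn2r _ 2) ?nnegrE ?mulr_ge0// exprMn real_normK ?num_real//.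
rewrite -!dot_norm -ler_pdivrMr// -subr_ge0; apply: le_trans h _.
by rewrite le_eqVlt; apply/orP; left; apply/eqP; field; rewrite gt_eqF.
Qed.

Lemma dot_ksec x y : Om x -> Om y -> dot (ksec H x) (ksec H y) = K y x.
Proof. by move=> Ox Oy; rewrite reproducing// ev_ksec. Qed.

Lemma norm_ksec x : Om x -> `|ksec H x| ^+ 2 = K x x.
Proof. by move=> Ox; rewrite -dot_norm dot_ksec. Qed.

Lemma normr_ev u x : Om x -> `|ev u x| <= `|u| * Num.sqrt (K x x).
Proof.
by move=> Ox; rewrite -reproducing// -norm_ksec// sqrtr_sqr normr_id normr_dot.
Qed.

End rkhs_dot.

(** * Directional derivatives of the functions of the Hilbert space *)

Section rkhs_deriv.
Context (R : realType) (n : nat) (Om : set 'rV[R]_n).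
Context (K : 'rV[R]_n -> 'rV[R]_n -> R) (H : rkhs Om K).
Hypothesis K_sym : forall x y, Om x -> Om y -> K x y = K y x.
Context (e : 'rV[R]_n) (G1 G2 : 'rV[R]_n * 'rV[R]_n -> R).
Hypothesis dK : forall z, interior (Om `*` Om) z ->
  is_derive z (e, 0 : 'rV[R]_n) (fun z => K z.1 z.2) (G1 z).
Hypothesis dG1 : forall z, interior (Om `*` Om) z ->
  is_derive z (0 : 'rV[R]_n, e) G1 (G2 z).
Hypothesis cG2 : {within Om `*` Om, continuous G2}.
Implicit Types u v : H.

(** Difference quotient of the map sending y to the section K_y. By reproduction, its inner product
    with [u] is the difference quotient of the function [ev u]. *)
Let dquot y h : H := h^-1 *: (ksec H (y + h *: e) - ksec H y).

Let ev_dquot u x d y h : step_in Om e x d y h ->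
  h^-1 *: ((ev u \o shift y) (h *: e) - ev u y) = dot u (dquot y h).
Proof.
move=> [h0 yh]; have [_ /interior_subset Oyh] := yh h (lexx _).
have := yh 0; rewrite normr0 scale0r addr0 => /(_ (normr_ge0 _))[_].
move=> /interior_subset Oy.
by rewrite dotZr dotBr !reproducing//= (addrC (h *: e)).
Qed.

(** In [|a - b|^2 = <a,a> - <a,b> - <b,a> + <b,b>] all four inner products are mixed quotients of
    [K], each within [eps^2 / 4] of the same number [G2 (x, x)]. *)
Let dquot_cauchy x eps : Om x -> 0 < eps ->
  exists2 d, 0 < d & forall y z h k, step_in Om e x d y h -> step_in Om e x d z k ->
  `|dquot y h - dquot z k| <= eps.
Proof.
move=> Ox e0.
have e40 : 0 < eps ^+ 2 / 4 by rewrite divr_gt0// exprn_gt0.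
have [d d0 Hd] := mixed_quotient_cvg dK dG1 cG2 Ox e40.
exists d => // y z h k yh zk.
have dE y' z' h' k' : step_in Om e x d y' h' -> step_in Om e x d z' k' ->
    `|dot (dquot y' h') (dquot z' k') - G2 (x, x)| <= eps ^+ 2 / 4.
  move=> yh' zk'; apply: le_trans (Hd _ _ _ _ yh' zk').
  case: yh' zk' => h0 yh' [k0 zk'].
  have Oy : Om y' by have := yh' 0; rewrite normr0 scale0r addr0;
    case=> // _ /interior_subset.
  have Oz : Om z' by have := zk' 0; rewrite normr0 scale0r addr0;
    case=> // _ /interior_subset.
  have [_ /interior_subset Oyh] := yh' h' (lexx _).
  have [_ /interior_subset Ozk] := zk' k' (lexx _).
  rewrite dotZl dotZr dotBl !dotBr !dot_ksec// le_eqVlt; apply/orP; left.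
  rewrite invfM -!mulrA; apply/eqP; congr (`|_ * (_ * _) - _|).
  (* [dot_ksec] returns the kernel with its arguments swapped; symmetry restores the order of the
     mixed difference. *)
  rewrite (K_sym Ozk Oyh) (K_sym Ozk Oy) (K_sym Oz Oyh) (K_sym Oz Oy); ring.
rewrite -(@ler_pXn2r _ 2) ?nnegrE// ?(ltW e0)// -dot_norm dotBl !dotBr.
have := (dE _ _ _ _ yh yh); have := (dE _ _ _ _ zk zk).
have := (dE _ _ _ _ yh zk); have := (dE _ _ _ _ zk yh).
rewrite !ler_norml => /andP[a1 a2] /andP[a3 a4] /andP[a5 a6] /andP[a7 a8].
lra.
Qed.

Lemma rkhs_derivable u y : interior Om y -> derivable (ev u) y e.
Proof.
move=> Oy; have Oy' := interior_subset Oy.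
apply: cvg_cauchy_pairs => eps e0.
have u1 : 0 < `|u| + 1 by rewrite ltr_wpDl.
have [d d0 Hd] := @dquot_cauchy y _ Oy' (divr_gt0 e0 u1).
exists (step_in Om e y d y); first exact: step_in_near (ballxx y d0) Oy.
move=> p q ph qh; rewrite (ev_dquot u ph) (ev_dquot u qh) -dotBr.
apply: le_trans (normr_dot _ _) _.
apply: le_trans (ler_wpM2l _ (Hd _ _ _ _ ph qh)) _ => //.
by rewrite mulrCA ler_piMr ?(ltW e0)// ler_pdivrMr// mul1r lerDl.
Qed.

(** The Cauchy bound passes to the limit along a common step [h] at [y] and [z]. The radius does not
    depend on [u], and [x] may be a boundary point, which yields the continuous extension of the
    derivative. *)
Lemma rkhs_derive_cauchy x eps : Om x -> 0 < eps ->
  exists2 d, 0 < d & forall u y z, ball x d y -> interior Om y ->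
    ball x d z -> interior Om z ->
    `|'D_e (ev u) y - 'D_e (ev u) z| <= `|u| * eps.
Proof.
move=> Ox e0.
have [d d0 Hd] := @dquot_cauchy x _ Ox e0.
exists d => // u y z xy Oy xz Oz.
have cq w : interior Om w ->
    (fun h => h^-1 *: ((ev u \o shift w) (h *: e) - ev u w)) @ 0^'
    --> 'D_e (ev u) w.
  by move=> Ow; exact: (rkhs_derivable Ow).
have sy := step_in_near e d0 xy Oy.
have sz := step_in_near e d0 xz Oz.
have cv := cvg_norm (cvgB (cq y Oy) (cq z Oz)).
have := closed_cvg (fun r : R => r <= `|u| * eps) (@closed_le _ _) _ _ (cv _ _).
apply.
apply: filterS2 sy sz => h yh zh.
rewrite !fctE (ev_dquot u yh) (ev_dquot u zh) -dotBr.
exact: le_trans (normr_dot _ _) (ler_wpM2l _ (Hd _ _ _ _ yh zh)).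
Qed.

(** The closure hypothesis makes the trace of the neighbourhoods of [x] on the interior a proper
    filter. *)
Lemma rkhs_partial_cvg u x : closure (interior Om) x -> Om x ->
  cvg ('D_e (ev u) y @[y --> within (interior Om) (nbhs x)]).
Proof.
move=> cx Ox.
have PF : ProperFilter (within (interior Om) (nbhs x)).
  by apply: within_nbhs_proper.
apply: cvg_cauchy_pairs => eps e0.
have u1 : 0 < `|u| + 1 by rewrite ltr_wpDl.
have [d d0 Hd] := @rkhs_derive_cauchy x _ Ox (divr_gt0 e0 u1).
exists (ball x d `&` interior Om).
  rewrite /within /=; apply: filterS (nbhsx_ballx x d d0) => y xy Oy.
  by split.
move=> p q [xp Op] [xq Oq]; apply: le_trans (Hd _ _ _ xp Op xq Oq) _.
by rewrite mulrCA ler_piMr ?(ltW e0)// ler_pdivrMr// mul1r lerDl.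
Qed.

Lemma rkhs_derive_linear a u v y : interior Om y ->
  'D_e (ev (a *: u + v)) y = a * 'D_e (ev u) y + 'D_e (ev v) y.
Proof.
move=> Oy.
(* [evDZ] holds only on [Om], so the two functions are known to agree only near the interior point
   [y]. *)
have -> : 'D_e (ev (a *: u + v)) y = 'D_e (a \*: ev u \+ ev v) y.
  apply: near_eq_derive; have : nbhs y (interior Om).
    by apply: open_nbhs_nbhs; split => //; exact: open_interior.
  by apply: filterS => z /interior_subset Oz; rewrite evDZ.
have du := DeriveDef (@rkhs_derivable u y Oy) erefl.
have dv := DeriveDef (@rkhs_derivable v y Oy) erefl.
by have [_ ->] := is_deriveD (is_deriveZ a du) dv.
Qed.

(** [lim] is a total function that is additive only along convergent families, hence the recourse to
    [rkhs_partial_cvg]. *)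
Lemma rkhs_partial_linear a u v x : closure (interior Om) x -> Om x ->
  lim ('D_e (ev (a *: u + v)) y @[y --> within (interior Om) (nbhs x)]) =
  a * lim ('D_e (ev u) y @[y --> within (interior Om) (nbhs x)]) +
  lim ('D_e (ev v) y @[y --> within (interior Om) (nbhs x)]).
Proof.
move=> cx Ox.
have PF : ProperFilter (within (interior Om) (nbhs x)).
  exact: within_nbhs_proper.
have cu := @rkhs_partial_cvg u x cx Ox.
have cv := @rkhs_partial_cvg v x cx Ox.
apply: cvg_lim => //.
have cuv := cvgD (cvgM (cvg_cst a) cu) cv.
apply: cvg_trans (cuv _ _ _).
apply: near_eq_cvg.
have : within (interior Om) (nbhs x) (interior Om) by exact: withinT.
by apply: filterS => y Oy; rewrite rkhs_derive_linear.
Qed.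
End rkhs_deriv.

(** * Linearity of the operator A *)

Section Aop_linear.
Context (R : realType) (n m : nat) (Om : set 'rV[R]_n).
Hypothesis Om_closure : closure (interior Om) = Om.
Context (K : 'rV[R]_n -> 'rV[R]_n -> R) (H : rkhs Om K).
Hypothesis K_sym : forall x y, Om x -> Om y -> K x y = K y x.
Hypothesis K_smooth : Ck_kernel Om 2 K.
Context (f : 'rV[R]_n -> 'cV[R]_n) (g : 'rV[R]_n -> 'M[R]_(n, m)).
Context (mu : 'rV[R]_n -> 'cV[R]_m).
Local Notation A := (@Aop R n m Om K H f g mu).

Lemma Aop_linear a (u v : H) : A (a *: u + v) = a *: A u + A v.
Proof.
apply/funext => x; rewrite /Aop.
have -> (F G : 'rV[R]_n -> R) : (a *: F + G) x = a * F x + G x by [].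
have [Ox|nOx] := pselect (Om x); last first.
  by rewrite /patch memNset// [a * 0]mulr0 addr0.
rewrite /patch mem_set//.
rewrite mulr_sumr -big_split; apply: eq_bigr => k _ /=.
rewrite mulrCA -mulrDr; congr (_ * _).
(* The two orders of smoothness are spent on one derivative in each argument, both along the [k]-th
   axis. *)
have [_ /(_ (inl k))[G1 [_ /(_ (inr k))[G2 [cG2 _] dG1]] dK]] := K_smooth.
by apply: (rkhs_partial_linear K_sym dK dG1 cG2) => //; rewrite Om_closure.
Qed.
End Aop_linear.

(** * Lebesgue measure and L^2 on a compact set *)

Section measure.
Context (R : realType) (n : nat).
Local Notation E := 'rV[R]_n.
Local Notation leb := (lebesgue_rV R n).

Lemma measurable_ball_rV (c : E) (r : R) : 0 < r -> measurable (ball c r).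
Proof.
move=> r0.
rewrite (_ : ball c r = \bigcap_(i in [set: 'I_n])
   ((fun x : E => x ord0 i) @^-1` ball (c ord0 i) r)).
  apply: fin_bigcap_measurable => // i _.
  rewrite -[X in measurable X]setTI; apply: measurable_rV_coord => //.
  exact: measurable_ball.
apply/seteqP; split => x /=.
  by case=> _ cx i _; exact: cx.
by move=> cx; split => // i j; rewrite (ord1 i); exact: cx.
Qed.

(** The sigma-algebra is generated by coordinates, so an open set is written as the countable union
    of the balls inside it that have a rational center and a radius [1 / (k + 1)]. *)
Lemma open_measurable_rV (U : set E) : open U -> measurable U.
Proof.
move=> oU.
pose B (q : 'rV[rat]_n * nat) : set E := ball (map_mx ratr q.1 : E) q.2.+1%:R^-1.
have -> : U = \bigcup_q (if `[< B q `<=` U >] then B q else set0).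
  apply/seteqP; split => [x Ux|x [q _]]; last first.
    by case: asboolP => // qU /qU.
  have /nbhs_ballP[e /= e0 xeU] : nbhs x U by exact: open_nbhs_nbhs.
  have e2 : 0 < e / 2 by rewrite divr_gt0.
  (* With a radius below [e / 2], a ball that contains [x] stays within distance [e] of [x]. *)
  pose k := Num.truncn (e / 2)^-1.
  have ke : k.+1%:R^-1 < e / 2.
    by rewrite invf_plt ?posrE//; exact: truncnS_gt.
  have k0 : 0 < k.+1%:R^-1 :> R by rewrite invr_gt0.
  have [c xc] : exists c : 'I_n -> rat,
      forall i, `|x ord0 i - ratr (c i)| < k.+1%:R^-1.
    suff : forall i, exists c : rat, `|x ord0 i - ratr c| < k.+1%:R^-1.
      by move=> /choice[c cP]; exists c.
    move=> i.
    have [|q] := @rat_in_itvoo R (x ord0 i - k.+1%:R^-1) (x ord0 i + k.+1%:R^-1).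
      by rewrite ltr_wpDr// ?ltrBlDr ?ltrDl// ltW.
    rewrite in_itv/= => /andP[q1 q2]; exists q.
    by rewrite distrC ltr_distl q1 q2.
  pose q : 'rV[rat]_n * nat := (\row_i c i, k).
  have Bx : B q x.
    by split => // i j; rewrite !mxE -ball_normE /= (ord1 i) distrC; exact: xc.
  exists q => //; case: asboolP => // -[] y By; apply: xeU.
  rewrite [e]splitr; apply: ball_triangle (ball_sym _) _.
    exact: le_ball (ltW ke) _ Bx.
  exact: le_ball (ltW ke) _ By.
apply: countable_bigcupT_measurable => [|q]; first exact: countableP.
case: asboolP => // _.
by apply: measurable_ball_rV; rewrite invr_gt0.
Qed.

Lemma compact_measurable_rV (D : set E) : compact D -> measurable D.
Proof.
move=> /(compact_closed (@norm_hausdorff _ _)) cD.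
rewrite -[D]setCK; apply: measurableC; apply: open_measurable_rV.
exact: closed_openC.
Qed.

Lemma within_continuous_measurable_rV (D : set E) (f : E -> R) : measurable D ->
  {within D, continuous f} -> measurable_fun D f.
Proof.
move=> mD /continuousP cf.
apply: (measurability _ (RGenOpens.measurableE R)) => _ [_ [a [b ->] <-]].
have /open_subspaceP[V oV VD] := cf _ (@interval_open R (BRight a) (BLeft b) isT isT).
by rewrite setIC -VD; apply: measurableI => //; exact: open_measurable_rV.
Qed.

Lemma compact_lebesgue_rV_fin (D : set E) : compact D -> (leb D < +oo)%E.
Proof.
move=> cD; have [M [_ MD]] := compact_bounded cD.
(* Boundedness gives an estimate for every number exceeding [M], hence the half-side [M + 1] of the
   enclosing cube. *)
pose A (i : 'I_n) : set (measurableTypeR R) := `[- (M + 1), M + 1]%classic.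
have mA i : measurable (A i) by exact: measurable_itv.
have DA : D `<=` [set x : E | forall i, A i (x ord0 i)].
  move=> x Dx i; rewrite /A /= in_itv /= -ler_norml.
  apply: le_trans (MD (M + 1) _ x Dx); last by rewrite ltrDl.
  rewrite [leRHS]/Num.norm /= mx_normrE.
  exact: (le_bigmax _ (fun ij : 'I_1 * 'I_n => `|x ij.1 ij.2|) (ord0, i)).
apply: (@le_lt_trans _ _ (leb [set x : E | forall i, A i (x ord0 i)])).
  apply: le_measure => //; rewrite ?inE; first exact: compact_measurable_rV.
  rewrite [X in measurable X](_ : _ = \bigcap_(i in [set: 'I_n])
     ((fun x : E => x ord0 i) @^-1` A i)).
    apply: fin_bigcap_measurable => // i _.
    by rewrite -[X in measurable X]setTI; exact: measurable_rV_coord.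
  by apply/seteqP; split=> x /=; [move=> h i _; exact: h|move=> h i; exact: h].
rewrite lebesgue_rV_box//.
suff /andP[] : (0 <= \prod_(i < n) lebesgue_measure (A i) < +oo)%E by [].
apply: (big_ind (fun z : \bar R => 0 <= z < +oo)%E); first by rewrite lee01 ltry.
  move=> x y /andP[x0 xoo] /andP[y0 yoo].
  by rewrite mule_ge0// lte_mul_pinfty// ge0_fin_numE.
move=> i _; rewrite measure_ge0 /A lebesgue_measure_itv /=.
by case: ifP => _; rewrite ?ltry.
Qed.
End measure.

(** For [c > 0] the minimizer [- b / c] is inserted. For [c = 0] and [b] nonzero the chosen [t]
    gives the value -1. The degenerate case is kept because the L^2 form vanishes on null
    functions. *)
Lemma ge0_quadratic_disc (R : realFieldType) (a b c : R) : 0 <= c ->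
  (forall t, 0 <= a + 2 * t * b + t ^+ 2 * c) -> b ^+ 2 <= a * c.
Proof.
rewrite le_eqVlt => /predU1P[<-|c0] h.
  have [->|b0] := eqVneq b 0; first by rewrite expr0n mulr0.
  have := h (- (a + 1) / (2 * b)).
  have -> : a + 2 * (- (a + 1) / (2 * b)) * b + (- (a + 1) / (2 * b)) ^+ 2 * 0 = -1.
    by field.
  by rewrite oppr_ge0 ler10.
have := h (- b / c).
have -> : a + 2 * (- b / c) * b + (- b / c) ^+ 2 * c = a - b ^+ 2 / c.
  by field; rewrite gt_eqF.
by rewrite subr_ge0 ler_pdivrMr.
Qed.

(** * Inner product and norm of L^2 on the domain *)

Section L2_theory.
Context (R : realType) (n : nat) (Om : set 'rV[R]_n).
Local Notation E := 'rV[R]_n.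
Local Notation leb := (lebesgue_rV R n).
Hypothesis Om_compact : compact Om.
Implicit Types f g h : E -> R.

Let mOm : measurable Om := compact_measurable_rV Om_compact.

Lemma sqr_Lnorm f :
  ('N[leb]_2%:E[EFin \o (f \_ Om)] `^ 2 = \int[leb]_(x in Om) (f x * f x)%:E)%E.
Proof.
rewrite powR_Lnorm// [RHS]integral_mkcond; apply: eq_integral => x _ /=.
rewrite /patch; case: ifP => _; last by rewrite normr0 powR0.
by rewrite powR_mulrn// real_normK ?num_real// expr2.
Qed.

Lemma inL2_lin a f g : inL2 Om f -> inL2 Om g -> inL2 Om (fun x => a * f x + g x).
Proof.
move=> f2 g2; rewrite /inL2.
have -> : (fun x => a * f x + g x) \_ Om = a *: (f \_ Om) + (g \_ Om).
  apply/funext => x; rewrite -[RHS]/(a * (f \_ Om) x + (g \_ Om) x) /patch.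
  by case: ifP => _ //; rewrite mulr0 addr0.
have [_ h] := Lfun_submod_closed leb (lee1n 2).
exact: h.
Qed.

Lemma inL2B f g : inL2 Om f -> inL2 Om g -> inL2 Om (fun x => f x - g x).
Proof.
move=> f2 g2; have := inL2_lin (-1) g2 f2; congr (inL2 _ _).
by apply/funext => x; rewrite mulN1r addrC.
Qed.

Lemma inL2M f g : inL2 Om f -> inL2 Om g ->
  leb.-integrable Om (EFin \o (fun x => f x * g x)).
Proof.
move=> f2 g2; apply/(integrable_mkcond _ mOm).
have /Lfun1_integrable := Lfun2_mul_Lfun1 f2 g2.
congr (integrable _ _ _); apply/funext => x; rewrite /= /patch.
by case: ifP => _ //; rewrite mulr0.
Qed.

Lemma dotL2C f g : dotL2 Om f g = dotL2 Om g f.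
Proof. by apply: eq_Rintegral => x _; rewrite mulrC. Qed.

Lemma dotL2_lin a f g h : inL2 Om f -> inL2 Om g -> inL2 Om h ->
  dotL2 Om (fun x => a * f x + g x) h = a * dotL2 Om f h + dotL2 Om g h.
Proof.
move=> f2 g2 h2; rewrite /dotL2.
rewrite -RintegralZl//; last exact: inL2M.
rewrite -RintegralD//; last 2 first.
- rewrite (_ : _ \o _ = (fun x => a%:E * (f x * h x)%:E)%E)//.
  exact: integrableZl (inL2M f2 h2).
- exact: inL2M.
by apply: eq_Rintegral => x _; rewrite mulrDl mulrA.
Qed.

Lemma dotL2B f g h : inL2 Om f -> inL2 Om g -> inL2 Om h ->
  dotL2 Om (fun x => f x - g x) h = dotL2 Om f h - dotL2 Om g h.
Proof.
move=> f2 g2 h2; have := dotL2_lin (-1) g2 f2 h2.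
rewrite mulN1r addrC => <-.
by apply: eq_Rintegral => x _; rewrite mulN1r [- _ + _]addrC.
Qed.

Lemma dotL2_ge0 f : 0 <= dotL2 Om f f.
Proof. by apply: Rintegral_ge0 => x _; rewrite -expr2 sqr_ge0. Qed.

Lemma normL2_ge0 f : 0 <= normL2 Om f.
Proof. by apply: fine_ge0; exact: Lnorm_ge0. Qed.

Lemma normL2_sqr f : inL2 Om f -> normL2 Om f ^+ 2 = dotL2 Om f f.
Proof.
move=> /andP[_]; rewrite inE /= /finite_norm => f2.
have f_fin : ('N[leb]_2%:E[EFin \o (f \_ Om)])%E \is a fin_num.
  by rewrite ge0_fin_numE ?Lnorm_ge0.
rewrite /dotL2 /Rintegral -sqr_Lnorm -(fineK f_fin) poweR_EFin /=.
by rewrite powR_mulrn// fine_ge0 ?Lnorm_ge0.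
Qed.

(** Cauchy-Schwarz through the discriminant, since a zero norm does not make a function zero and
    division by it has to be avoided. *)
Lemma normr_dotL2 f g : inL2 Om f -> inL2 Om g ->
  `|dotL2 Om f g| <= normL2 Om f * normL2 Om g.
Proof.
move=> f2 g2; rewrite -(@ler_pXn2r _ 2) ?nnegrE ?mulr_ge0 ?normL2_ge0//.
rewrite exprMn !normL2_sqr// real_normK ?num_real//.
apply: ge0_quadratic_disc => [|t]; first exact: dotL2_ge0.
have tgf := inL2_lin t g2 f2.
have := dotL2_ge0 (fun x => t * g x + f x).
rewrite dotL2_lin// !(dotL2C _ (fun x => t * g x + f x)) !dotL2_lin// (dotL2C g f).
by congr (_ <= _); ring.
Qed.

Lemma bounded_inL2 f M : measurable_fun Om f ->
  (forall x, Om x -> `|f x| <= M) -> inL2 Om f.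
Proof.
move=> mf fM; apply/andP; rewrite !inE /= /finite_norm; split.
  exact: ((measurable_restrictT f mOm).1 mf).
apply: (@lty_poweRy _ _ 2) => //; rewrite sqr_Lnorm.
apply: integrable_lty => //.
apply: measurable_bounded_integrable => //.
- exact: compact_lebesgue_rV_fin.
- exact: measurable_funM.
- exists (M * M); split; first exact: num_real.
  move=> N MN x Ox; apply: le_trans (ltW MN); rewrite normrM.
  by apply: ler_pM => //; exact: fM.
Qed.

Lemma continuous_inL2 f : {within Om, continuous f} -> inL2 Om f.
Proof.
move=> cf; have [M [_ MP]] := compact_bounded (continuous_compact cf Om_compact).
apply: (@bounded_inL2 _ (M + 1)).
  exact: within_continuous_measurable_rV.
by move=> x Ox; apply: (MP (M + 1)); [rewrite ltrDl|exists x].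
Qed.

Lemma le_normL2 f M : 0 <= M -> inL2 Om f -> (forall x, Om x -> `|f x| <= M) ->
  normL2 Om f <= M * Num.sqrt (fine (leb Om)).
Proof.
move=> M0 f2 fM.
rewrite -(@ler_pXn2r _ 2) ?nnegrE ?mulr_ge0 ?sqrtr_ge0 ?normL2_ge0//.
rewrite exprMn normL2_sqr// sqr_sqrtr ?fine_ge0//.
rewrite -Rintegral_cst//; apply: le_Rintegral => //.
- exact: inL2M.
- apply: measurable_bounded_integrable => //.
  + exact: compact_lebesgue_rV_fin.
  + exists (M ^+ 2); split; first exact: num_real.
    by move=> N MN x Ox; rewrite /= ger0_norm ?sqr_ge0// ltW.
- move=> x Ox; rewrite -expr2 -(@real_normK _ (f x)) ?num_real//.
  by rewrite ler_pXn2r ?nnegrE// fM.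
Qed.

End L2_theory.

(** * Source condition and power function *)

Section rkhs_functional.
Context (R : realType) (n : nat) (Om : set 'rV[R]_n).
Context (K : 'rV[R]_n -> 'rV[R]_n -> R) (H : rkhs Om K).
Implicit Types u v w : H.

Lemma parallelogram u v : `|u - v| ^+ 2 = 2 * `|u| ^+ 2 + 2 * `|v| ^+ 2 - `|u + v| ^+ 2.
Proof. by rewrite -!dot_norm dotBl dotDl !dotBr !dotDr (dotC v u); ring. Qed.

(* A point u is compared with its best approximation w in the kernel of phi:
   u - w is orthogonal to the sections of the kernel, hence zero. *)
Lemma bounded_functional_eq0 (phi : H -> R) (C : R) :
  (forall a u v, phi (a *: u + v) = a * phi u + phi v) ->
  (forall u, `|phi u| <= C * `|u|) ->
  (forall x, Om x -> phi (ksec H x) = 0) -> forall u, phi u = 0.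
Proof.
move=> lin bnd phiK u.
have phi0 : phi 0 = 0.
  by apply/eqP; rewrite -normr_le0; apply: le_trans (bnd 0) _; rewrite normr0 mulr0.
pose D := [set `|u - w| | w in [set w | phi w = 0]].
have D0 : lbound D 0 by move=> _ [w _ <-].
have infD : has_inf D by split; [exists `|u - 0|, 0|exists 0].
have d0 : 0 <= inf D by apply: lb_le_inf => //; case: infD.
set d := inf D in d0.
have dP w : phi w = 0 -> d <= `|u - w|.
  by move=> w0; apply: ge_inf; [exists 0|exists w].
(* Near-minimizers of the distance from [u] to the kernel of [phi]; the parallelogram identity makes
   them a Cauchy filter. *)
pose B e := [set w | phi w = 0 /\ `|u - w| < d + e].
pose F := filter_from [set e : R | 0 < e] B.
have FF : ProperFilter F.
  apply: filter_from_proper; first apply: filter_from_filter.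
  - by exists 1 => /=.
  - move=> i j /= i0 j0; exists (Num.min i j); first by rewrite /= lt_min i0 j0.
    by move=> w [w0]; rewrite -ltrBlDl lt_min !ltrBlDl => /andP[wi wj].
  by move=> e /= e0; have [_ [w w0 <-] we] := inf_adherent e0 infD; exists w.
have cF : cvg (id @ F).
  apply: cvg_cauchy_pairs => eps e0.
  have d1 : 0 < 8 * d + 4 by rewrite ltr_wpDl// mulr_ge0.
  (* The parallelogram identity leaves [4 (d + e)^2 - 4 d^2 = 8 d e + 4 e^2], at most [e (8 d + 4)]
     because [e <= 1], hence at most [eps^2]. *)
  pose e := Num.min 1 (eps ^+ 2 / (8 * d + 4)).
  have e1 : 0 < e by rewrite lt_min ltr01 divr_gt0// exprn_gt0.
  exists (B e); first by exists e.
  move=> w z [w0 we] [z0 ze].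
  rewrite -(@ler_pXn2r _ 2) ?nnegrE ?(ltW e0)//.
  have -> : w - z = (u - z) - (u - w) by rewrite opprB [RHS]addrC subrKA.
  rewrite parallelogram.
  have -> : u - z + (u - w) = 2 *: (u - 2^-1 *: (z + w)).
    rewrite scalerBr scalerA divff// scale1r scaler_nat mulr2n opprD addrACA.
    by [].
  have mid : d <= `|u - 2^-1 *: (z + w)|.
    by apply: dP; rewrite -[_ *: _]addr0 lin -[z]scale1r lin z0 w0 phi0; ring.
  rewrite normrZ (ger0_norm (ler0n _ 2)) exprMn.
  have q1 : `|u - w| ^+ 2 <= (d + e) ^+ 2.
    by rewrite ler_pXn2r ?nnegrE ?addr_ge0 ?(ltW we) ?(ltW e1).
  have q2 : `|u - z| ^+ 2 <= (d + e) ^+ 2.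
    by rewrite ler_pXn2r ?nnegrE ?addr_ge0 ?(ltW ze) ?(ltW e1).
  have q3 : d ^+ 2 <= `|u - 2^-1 *: (z + w)| ^+ 2 by rewrite ler_pXn2r ?nnegrE.
  have e2 : e ^+ 2 <= e by rewrite expr2 ler_piMr ?(ltW e1)// ge_min lexx.
  have e3 : e * (8 * d + 4) <= eps ^+ 2.
    by rewrite -ler_pdivlMr// ge_min lexx orbT.
  nra.
pose w := lim (id @ F).
have Fw e : 0 < e -> exists z, [/\ phi z = 0, `|u - z| < d + e & `|w - z| < e].
  move=> e0.
  have F1 : F (B e) by exists e.
  have F2 : F (ball w e) by apply: cF; exact: nbhsx_ballx.
  have [z [[z0 ze]]] := filter_ex (filterI F1 F2).
  by rewrite -ball_normE /= => wz; exists z.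
(* Boundedness of [phi] makes its kernel closed, so the limit stays in it. *)
have w0 : phi w = 0.
  apply/eqP; rewrite -normr_le0; apply/ler_addgt0Pl => e e0; rewrite addr0.
  have C1 : 0 < `|C| + 1 by rewrite ltr_wpDl.
  have [z [z0 _ wz]] := Fw _ (divr_gt0 e0 C1).
  have -> : phi w = phi (w - z).
    by rewrite addrC -scaleN1r lin z0 mulr0 add0r.
  apply: le_trans (bnd _) _.
  apply: (@le_trans _ _ ((`|C| + 1) * `|w - z|)).
    by rewrite ler_wpM2r// (le_trans (ler_norm C))// lerDl.
  by rewrite mulrC -ler_pdivlMr// ltW.
have uw : `|u - w| <= d.
  apply/ler_addgt0Pl => e e0.
  have e2 : 0 < e / 2 by rewrite divr_gt0.
  have [z [_ uz wz]] := Fw _ e2.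
  rewrite distrC in wz; rewrite -(subrKA z).
  by apply: le_trans (ler_normD _ _) _; lra.
suff -> : u = w by [].
apply: ev_inj => x Ox; apply/eqP; rewrite -!reproducing// -subr_eq0 -dotBl.
set z := ksec H x.
rewrite -sqrf_eq0 -[_ == _]negbK -[dot _ _]opprK sqrrN; apply/negP => nz.
(* Moving from [w] along [z] stays in the kernel, and [|u - w| <= d]; minimality therefore gives a
   nonnegative quadratic in [t] with zero constant term, which forces the linear coefficient to
   vanish. *)
have : (- dot (u - w) z) ^+ 2 <= 0 * `|z| ^+ 2.
  apply: ge0_quadratic_disc => [|t]; first exact: sqr_ge0.
  have : d <= `|u - (w + t *: z)|.
    by apply: dP; rewrite addrC lin phiK// w0 mulr0 addr0.
  rewrite opprD addrA -(@ler_pXn2r _ 2) ?nnegrE//.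
  rewrite -(dot_norm (u - w - t *: z)) (dotBl (u - w)) !(dotBr (u - w)).
  rewrite !dotZl !dotZr (dotC z) !dot_norm.
  have : `|u - w| ^+ 2 <= d ^+ 2 by rewrite ler_pXn2r ?nnegrE.
  lra.
by rewrite mul0r leNgt lt_neqAle eq_sym nz sqr_ge0.
Qed.
End rkhs_functional.

Lemma posdef_unitmx (F : fieldType) (N : nat) (G : 'M[F]_N) :
  (forall c : 'cV[F]_N, (c^T *m G *m c) ord0 ord0 = 0 -> c = 0) -> G \in unitmx.
Proof.
move=> G0; rewrite unitmxE unitfE; apply/det0P => -[v v0 vG].
move/eqP: v0; apply; apply: trmx_inj; rewrite trmx0; apply: G0.
by rewrite trmxK vG mul0mx mxE.
Qed.

(** * The integral operator and interpolation at the centers *)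

Section rkhs_source.
Context (R : realType) (n : nat) (Om : set 'rV[R]_n).
Hypothesis Om_compact : compact Om.
Context (K : 'rV[R]_n -> 'rV[R]_n -> R) (H : rkhs Om K).
Hypothesis K_sym : forall x y, Om x -> Om y -> K x y = K y x.
Hypothesis K_cont : {within Om `*` Om, continuous (fun z => K z.1 z.2)}.
Context (kappa : R).
Hypothesis kappa_ge0 : 0 <= kappa.
Hypothesis K_diag : forall x, Om x -> K x x <= kappa ^+ 2.
Implicit Types u v w : H.
Local Notation leb := (lebesgue_rV R n).

Lemma normr_ev_kappa u x : Om x -> `|ev u x| <= kappa * `|u|.
Proof.
move=> Ox; apply: le_trans (normr_ev u Ox) _; rewrite mulrC ler_wpM2r//.
by rewrite -[leRHS]ger0_norm// -sqrtr_sqr ler_wsqrtr// K_diag.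
Qed.

Lemma ev_continuous u : {within Om, continuous (ev u)}.
Proof.
apply/subspace_continuousP => x Ox; apply/cvgrPdist_le => eps e0.
have u1 : 0 < `|u| + 1 by rewrite ltr_wpDl.
(* The squared norm of [K_x - K_y] equals [2 (K(x,x) - K(y,x)) - (K(x,x) - K(y,y))], at most
   [3 r]. *)
pose r := (eps / (`|u| + 1)) ^+ 2 / 3.
have r0 : 0 < r by rewrite divr_gt0// exprn_gt0// divr_gt0.
have Oxx : (Om `*` Om) (x, x) by [].
have /cvgrPdist_le/(_ _ r0) := @K_cont (x, x).
rewrite /nbhs /= /nbhs_subspace mem_set//=.
move=> /nbhs_ballP[d /= d0 Hd].
rewrite /within /=; apply: filterS (nbhsx_ballx x d d0) => y xy Oy.
have Kyy : `|K x x - K y y| <= r := Hd (y, y) (conj xy xy) (conj Oy Oy).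
have Kyx : `|K x x - K y x| <= r := Hd (y, x) (conj xy (ballxx x d0)) (conj Oy Ox).
change (`|ev u x - ev u y| <= eps).
rewrite -(reproducing u Ox) -(reproducing u Oy) -dotBr.
apply: le_trans (normr_dot _ _) _.
have Kxy : `|ksec H x - ksec H y| <= eps / (`|u| + 1).
  rewrite -(@ler_pXn2r _ 2) ?nnegrE ?divr_ge0 ?(ltW e0) ?(ltW u1)//.
  rewrite -dot_norm dotBl !dotBr !dot_ksec// (K_sym Ox Oy).
  have -> : (eps / (`|u| + 1)) ^+ 2 = 3 * r by rewrite [RHS]mulrC divfK.
  move: Kyy Kyx; rewrite !ler_norml => /andP[a1 a2] /andP[a3 a4].
  clearbody r; lra.
apply: (@le_trans _ _ (`|u| * (eps / (`|u| + 1)))); first exact: ler_wpM2l.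
by rewrite mulrCA ler_piMr ?(ltW e0)// ler_pdivrMr// mul1r lerDl.
Qed.

Lemma ev_inL2 u : inL2 Om (ev u).
Proof. exact/continuous_inL2/ev_continuous. Qed.

(** The integral operator is the adjoint of the embedding into L^2. On sections this is reproduction
    and symmetry of [K]; [bounded_functional_eq0] extends it without any integral with values in
    [H]. *)
Lemma dot_integral_op v p u : inL2 Om p ->
  (forall x, Om x -> ev v x = integral_op Om K p x) ->
  dot v u = dotL2 Om p (ev u).
Proof.
move=> p2 vp; apply/eqP; rewrite -subr_eq0; apply/eqP; move: u.
apply: (@bounded_functional_eq0 _ _ _ _ _ _
  (`|v| + normL2 Om p * (kappa * Num.sqrt (fine (leb Om))))).
- move=> a u w; rewrite dotDr dotZr.
  have -> : dotL2 Om p (ev (a *: u + w)) =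
      a * dotL2 Om p (ev u) + dotL2 Om p (ev w).
    rewrite !(dotL2C _ p) -dotL2_lin//; try exact: ev_inL2.
    by apply: eq_Rintegral => x /set_mem Ox; rewrite evDZ.
  ring.
- move=> u; apply: le_trans (ler_normB _ _) _; rewrite mulrDl.
  apply: lerD; first exact: normr_dot.
  apply: le_trans (normr_dotL2 _ _ _) _ => //; first exact: ev_inL2.
  rewrite -mulrA ler_wpM2l ?normL2_ge0// mulrAC.
  apply: le_normL2 => //; first exact: mulr_ge0.
    exact: ev_inL2.
  by move=> x Ox; exact: normr_ev_kappa.
- move=> x Ox; rewrite reproducing// vp//; apply/eqP; rewrite subr_eq0; apply/eqP.
  apply: eq_Rintegral => y /set_mem Oy.
  by rewrite ev_ksec// mulrC (K_sym Ox Oy).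
Qed.

Section centers.
Context (N : nat) (xi : 'I_N -> 'rV[R]_n).
Hypothesis xi_Om : forall i, Om (xi i).
Hypothesis gram_unit : gram_mx K xi \in unitmx.

(** The kernel interpolant of [w] at the centers, which is also the orthogonal projection of [w]
    onto [HN]. *)
Definition HN_proj w : H :=
  \sum_(i < N) (invmx (gram_mx K xi) *m \col_j ev w (xi j)) i ord0 *: ksec H (xi i).

Lemma HN_proj_in w : HN H xi (HN_proj w).
Proof.
by exists (fun i => (invmx (gram_mx K xi) *m \col_j ev w (xi j)) i ord0).
Qed.

(** Orthogonality to the section at a center means, by reproduction, that the residual vanishes
    there; the Gram system expresses exactly this. *)
Lemma HN_proj_orth w h : HN H xi h -> dot (w - HN_proj w) h = 0.
Proof.
move=> [c ->]; rewrite dotC dot_suml big1// => i _.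
rewrite dotZl dotC reproducing//; apply/eqP; rewrite mulf_eq0; apply/orP; right.
rewrite -reproducing// dotBl reproducing// /HN_proj dot_suml subr_eq0; apply/eqP.
set c' := invmx _ *m _.
have : (gram_mx K xi *m c') i ord0 = ev w (xi i).
  by rewrite /c' mulmxA mulmxV// mul1mx mxE.
move=> <-; rewrite mxE; apply: eq_bigr => j _.
by rewrite dotZl dot_ksec// mxE mulrC.
Qed.

(** The residual of K_x is orthogonal to its projection, so its squared norm is the inner product of
    the residual with K_x, which is the quantity under the root. *)
Lemma power_functionE x : Om x ->
  power_function K xi x = `|ksec H x - HN_proj (ksec H x)|.
Proof.
move=> Ox; rewrite -[RHS]ger0_norm// -sqrtr_sqr /power_function; congr Num.sqrt.
rewrite -dot_norm dotBr (HN_proj_orth _ (HN_proj_in _)) subr0 dotBl dot_ksec//.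
congr (_ - _); rewrite -mulmxA mxE /HN_proj dot_suml; apply: eq_bigr => i _.
rewrite !mxE dotZl dot_ksec// mulrC; congr (_ * _).
have -> // : kernel_col K xi x = \col_j ev (ksec H x) (xi j).
by apply/matrixP => j k; rewrite !mxE ev_ksec// K_sym.
Qed.

(** A projection residual is no longer than the vector. The bound makes the set of values bounded
    above, so that its [sup] dominates each of them. *)
Lemma power_function_le x : Om x -> power_function K xi x <= kappa.
Proof.
move=> Ox; rewrite power_functionE//.
set w := ksec H x; set r := w - _.
have rr : `|r| * `|r| <= `|r| * `|w|.
  rewrite -expr2 -dot_norm {2}/r dotBr (HN_proj_orth _ (HN_proj_in _)) subr0.
  exact: le_trans (ler_norm _) (normr_dot _ _).
have wk : `|w| <= kappa.
  by rewrite -(@ler_pXn2r _ 2) ?nnegrE// norm_ksec// K_diag.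
apply: le_trans wk; have [->|r0] := eqVneq r 0; first by rewrite normr0.
by rewrite -(ler_pM2l (_ : 0 < `|r|))// normr_gt0.
Qed.

Lemma HN_proj_power v p S : inL2 Om p ->
  (forall x, Om x -> ev v x = integral_op Om K p x) ->
  (forall x, Om x -> power_function K xi x <= S) -> 0 <= S ->
  `|v - HN_proj v| <= normL2 Om p * (S * Num.sqrt (fine (leb Om))).
Proof.
move=> p2 vp powS S0; set r := v - _.
have rr : `|r| * `|r| <= `|r| * (normL2 Om p * (S * Num.sqrt (fine (leb Om)))).
  rewrite -expr2 -dot_norm {1}/r dotBl.
  rewrite [X in _ - X]dotC (HN_proj_orth _ (HN_proj_in _)) subr0.
  rewrite (dot_integral_op _ p2 vp).
  apply: le_trans (ler_norm _) _.
  apply: le_trans (normr_dotL2 _ _ _) _ => //; first exact: ev_inL2.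
  rewrite mulrCA ler_wpM2l ?normL2_ge0// mulrA.
  apply: le_normL2 => //; [exact: mulr_ge0|exact: ev_inL2|move=> x Ox].
  (* As [r] is orthogonal to [HN], the section at [x] may be replaced by its own residual, whose
     norm is the power function. *)
  have -> : ev r x = dot r (ksec H x - HN_proj (ksec H x)).
    by rewrite dotBr reproducing// (HN_proj_orth _ (HN_proj_in _)) subr0.
  apply: le_trans (normr_dot _ _) _; rewrite ler_wpM2l//.
  by rewrite -power_functionE// powS.
have [->|r0] := eqVneq r 0.
  by rewrite normr0 !mulr_ge0 ?normL2_ge0// sqrtr_ge0.
by rewrite -(ler_pM2l (_ : 0 < `|r|))// normr_gt0.
Qed.
End centers.
End rkhs_source.

(** * The Galerkin scheme *)

Lemma lincomb_lin (R : realType) (V : lmodType R) N (e : 'I_N -> V) a u v :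
  lincomb e u -> lincomb e v -> lincomb e (a *: u + v).
Proof.
move=> [c ->] [d ->]; exists (fun i => a * c i + d i).
rewrite scaler_sumr -big_split; apply: eq_bigr => i _ /=.
by rewrite scalerA -scalerDl.
Qed.

(** * Galerkin equations for an operator stable on a finite-dimensional subspace *)

Section galerkin_abstract.
Context (R : realType) (n : nat) (Om : set 'rV[R]_n).
Hypothesis Om_compact : compact Om.
Local Notation E := 'rV[R]_n.
Context (H : normedModType R) (A : H -> E -> R).
Hypothesis A_lin : forall a u v, A (a *: u + v) = (fun x => a * A u x + A v x).
Hypothesis A_L2 : forall u, inL2 Om (A u).
Context (N : nat) (e : 'I_N -> H) (beta : R).
Hypothesis e_free : forall c : 'I_N -> R,
  \sum_(i < N) c i *: e i = 0 -> forall i, c i = 0.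
Hypothesis beta_ge0 : 0 <= beta.
Hypothesis A_stable : forall h, lincomb e h -> `|h| <= beta * normL2 Om (A h).
Implicit Types (u v h : H) (y z : E -> R).
Local Notation V := (lincomb e).
Local Notation Y := (lincomb (fun i => A (e i) : E -> R^o)).

Lemma lin_op0 : A 0 = cst 0.
Proof.
rewrite -[in LHS](addNr 0) -scaleN1r A_lin; apply/funext => x.
by rewrite mulN1r addNr.
Qed.

Lemma lin_opB u v : A (u - v) = (fun x => A u x - A v x).
Proof.
rewrite addrC -scaleN1r A_lin; apply/funext => x.
by rewrite mulN1r addrC.
Qed.

Lemma lin_op_sum (c : 'I_N -> R) :
  A (\sum_(i < N) c i *: e i) = \sum_(i < N) c i *: A (e i).
Proof.
have AD u v : A (u + v) = A u + A v.
  by rewrite -[u in LHS]scale1r A_lin; apply/funext => x; rewrite mul1r.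
rewrite (big_morph A AD lin_op0); apply: eq_bigr => i _.
rewrite -[_ *: _ in LHS]addr0 A_lin lin_op0; apply/funext => x; exact: addr0.
Qed.

Lemma lincomb_image h : V h -> Y (A h).
Proof. by move=> [c ->]; exists c; rewrite lin_op_sum. Qed.

Lemma lincomb_imageP y : Y y -> exists2 h, V h & A h = y.
Proof.
by move=> [c ->]; exists (\sum_(i < N) c i *: e i); [exists c|rewrite lin_op_sum].
Qed.

Lemma lincomb_image_inL2 y : Y y -> inL2 Om y.
Proof. by move=> /lincomb_imageP[h _ <-]. Qed.

(** The Galerkin equations. Since the test space is the image of the trial space, they are the
    normal equations of a least-squares problem. *)
Definition orth_residual y h := forall z, Y z -> dotL2 Om (A h) z = dotL2 Om y z.

(** Testing with [A h] itself gives [|A h|^2 = <y, A h> <= |y| |A h|] in L^2; stability then bounds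
    [h]. *)
Lemma orth_residual_bound y h : inL2 Om y -> V h -> orth_residual y h ->
  `|h| <= beta * normL2 Om y.
Proof.
move=> y2 Vh yh; apply: le_trans (A_stable Vh) _; rewrite ler_wpM2l//.
have AyA := yh _ (lincomb_image Vh).
have [->|nA] := eqVneq (normL2 Om (A h)) 0; first exact: normL2_ge0.
have pA : 0 < normL2 Om (A h) by rewrite lt_neqAle eq_sym nA normL2_ge0.
rewrite -(ler_pM2r pA) -expr2 normL2_sqr// AyA.
exact: le_trans (ler_norm _) (normr_dotL2 _ _ _).
Qed.

Lemma orth_residual_lin a y z h k : inL2 Om y -> inL2 Om z ->
  orth_residual y h -> orth_residual z k ->
  orth_residual (fun x => a * y x + z x) (a *: h + k).
Proof.
move=> y2 z2 yh zk w Yw; have w2 := lincomb_image_inL2 Yw.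
rewrite A_lin (dotL2_lin _ a (A_L2 h) (A_L2 k) w2)// (dotL2_lin _ a y2 z2 w2)//.
by congr (_ * _ + _); [exact: yh|exact: zk].
Qed.

(** The difference of two solutions solves the equations for data of zero L^2 norm. *)
Lemma orth_residual_uniq y h k : inL2 Om y -> V h -> V k ->
  orth_residual y h -> orth_residual y k -> h = k.
Proof.
move=> y2 Vh Vk yh yk; apply/eqP; rewrite -subr_eq0 -normr_le0 addrC -scaleN1r.
have z2 := inL2_lin (-1) y2 y2.
have := orth_residual_bound z2 (lincomb_lin (-1) Vk Vh)
  (orth_residual_lin (-1) y2 y2 yk yh).
move/le_trans; apply.
suff /eqP -> : normL2 Om (fun x => -1 * y x + y x) == 0 by rewrite mulr0.
by rewrite -sqrf_eq0 normL2_sqr// dotL2_lin// mulN1r addNr.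
Qed.

Lemma dotL2_A_sum (c : 'I_N -> R) z : inL2 Om z ->
  dotL2 Om (A (\sum_(i < N) c i *: e i)) z =
  \sum_(i < N) c i * dotL2 Om (A (e i)) z.
Proof.
move=> z2; pose phi u := dotL2 Om (A u) z.
have lin a u v : phi (a *: u + v) = a * phi u + phi v.
  by rewrite /phi A_lin dotL2_lin.
have lin0 : phi 0 = 0.
  by apply: (@addrI _ (1 * phi 0)); rewrite -lin scale1r !addr0 mul1r.
have linD u v : phi (u + v) = phi u + phi v.
  by rewrite -[u in LHS]scale1r lin mul1r.
rewrite [LHS](big_morph phi linD lin0).
by apply: eq_bigr => i _; rewrite -[_ *: _ in LHS]addr0 lin lin0 addr0.
Qed.

(** A null vector of the L^2 Gram matrix gives a combination whose image has zero norm; stability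
    makes the combination zero and freeness its coefficients. *)
Lemma orth_residual_ex y : inL2 Om y -> exists2 h, V h & orth_residual y h.
Proof.
move=> y2.
pose comb (c : 'cV[R]_N) := \sum_(i < N) c i ord0 *: e i.
have comb_V c : V (comb c) by exists (fun i => c i ord0).
pose G := \matrix_(i < N, j < N) dotL2 Om (A (e j)) (A (e i)).
have GE c i : (G *m c) i ord0 = dotL2 Om (A (comb c)) (A (e i)).
  rewrite mxE (dotL2_A_sum _ (A_L2 _)); apply: eq_bigr => j _.
  by rewrite mxE mulrC.
have sumE c w : inL2 Om w -> dotL2 Om w (A (\sum_(i < N) c i *: e i)) =
    \sum_(i < N) c i * dotL2 Om w (A (e i)).
  move=> w2; rewrite dotL2C (dotL2_A_sum _ w2); apply: eq_bigr => i _.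
  by rewrite dotL2C.
have Gunit : G \in unitmx.
  apply: posdef_unitmx => c; rewrite -mulmxA mxE => c0.
  have n0 : normL2 Om (A (comb c)) = 0.
    apply/eqP; rewrite -sqrf_eq0 normL2_sqr// (sumE _ _ (A_L2 _)) -[X in _ == X]c0.
    by apply/eqP; apply: eq_bigr => i _; rewrite GE mxE.
  have h0 : comb c = 0.
    apply/eqP; rewrite -normr_le0.
    by apply: le_trans (A_stable (comb_V c)) _; rewrite n0 mulr0.
  apply/matrixP => i j; rewrite (ord1 j) [RHS]mxE.
  exact: (e_free (c := fun i => c i ord0)).
pose c : 'cV[R]_N := invmx G *m \col_i dotL2 Om y (A (e i)).
exists (comb c); first exact: comb_V.
move=> z /lincomb_imageP[_ [d ->] <-].
rewrite (sumE _ _ (A_L2 (comb c))) (sumE _ _ y2); apply: eq_bigr => i _.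
by congr (_ * _); rewrite -GE /c mulmxA mulmxV// mul1mx mxE.
Qed.

Lemma projL2_spec y : inL2 Om y ->
  Y (projL2 Om Y y) /\
  forall z, Y z -> dotL2 Om (fun x => y x - projL2 Om Y y x) z = 0.
Proof.
move=> y2; rewrite /projL2.
apply: (getPex (P := [set w | Y w /\ _])).
have [h Vh yh] := orth_residual_ex y2; exists (A h); split; first exact: lincomb_image.
move=> z Yz; have z2 := lincomb_image_inL2 Yz.
by rewrite (dotL2B Om_compact y2 (A_L2 h) z2) (yh _ Yz) subrr.
Qed.

(** Every element of [Y] is the image of some vector of [V], and the Galerkin equations determine
    that vector. The projection is thus fixed as a function, not merely almost everywhere. *)
Lemma projL2_A y h : inL2 Om y -> V h ->
  projL2 Om Y y = A h <-> orth_residual y h.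
Proof.
move=> y2 Vh; have [/lincomb_imageP[k Vk kE]] := projL2_spec y2.
rewrite -kE => yk'.
have yk : orth_residual y k.
  move=> z Yz; apply/eqP; rewrite eq_sym -subr_eq0 -dotL2B ?yk'//.
  exact: lincomb_image_inL2.
split=> [kh|yh]; last by rewrite (orth_residual_uniq y2 Vh Vk yh yk).
by move=> z Yz; rewrite -kh yk.
Qed.

Lemma projL2_id h : V h -> projL2 Om Y (A h) = A h.
Proof. by move=> Vh; apply/projL2_A. Qed.

(* [GN] is the instance where A is [Aop] and e i is the section at [xi i]. *)
Definition galerkin y : H :=
  get [set h | V h /\ projL2 Om Y (A h) = projL2 Om Y y].

Lemma galerkin_spec y : inL2 Om y ->
  V (galerkin y) /\ orth_residual y (galerkin y).
Proof.
move=> y2; rewrite /galerkin.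
have [|] := getPex (P := [set h | V h /\ projL2 Om Y (A h) = projL2 Om Y y]).
  have [h Vh yh] := orth_residual_ex y2; exists h; split => //.
  by rewrite projL2_id//; apply/esym/projL2_A.
move: (get _) => h Vh yh.
by split => //; apply/projL2_A => //; rewrite -yh projL2_id.
Qed.

Lemma galerkin_bound y : inL2 Om y -> `|galerkin y| <= beta * normL2 Om y.
Proof. by move=> y2; have [Vh yh] := galerkin_spec y2; exact: orth_residual_bound. Qed.

Lemma galerkin_lin a y z : inL2 Om y -> inL2 Om z ->
  galerkin (fun x => a * y x + z x) = a *: galerkin y + galerkin z.
Proof.
move=> y2 z2; have [Vy yh] := galerkin_spec y2; have [Vz zh] := galerkin_spec z2.
have yz2 : inL2 Om (fun x => a * y x + z x) by exact: inL2_lin.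
have [Vyz yzh] := galerkin_spec yz2.
apply: (orth_residual_uniq yz2) => //; first exact: lincomb_lin.
exact: orth_residual_lin.
Qed.

Lemma galerkin_A h : V h -> galerkin (A h) = h.
Proof.
move=> Vh; have [Vk hk] := galerkin_spec (A_L2 h).
by apply: (orth_residual_uniq (A_L2 h)).
Qed.
End galerkin_abstract.

Lemma normr_le_orth (R : realType) n (Om : set 'rV[R]_n) K (H : rkhs Om K) (u v : H) :
  dot u v = 0 -> `|u| <= `|u + v|.
Proof.
move=> uv; rewrite -(@ler_pXn2r _ 2) ?nnegrE// -(dot_norm (u + v)) dotDl.
by rewrite !dotDr (dotC v u) uv !dot_norm addr0 add0r lerDl sqr_ge0.
Qed.

(** * The quotient norm on the range of A *)

Section galerkin_stability.
Context (R : realType) (n m : nat) (Om : set 'rV[R]_n).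
Context (K : 'rV[R]_n -> 'rV[R]_n -> R) (H : rkhs Om K).
Context (f : 'rV[R]_n -> 'cV[R]_n) (g : 'rV[R]_n -> 'M[R]_(n, m)).
Context (mu : 'rV[R]_n -> 'cV[R]_m).
Local Notation A := (@Aop R n m Om K H f g mu).
Hypothesis A_lin : forall a (u v : H), A (a *: u + v) = (fun x => a * A u x + A v x).
Implicit Types u h : H.

Lemma has_lbound_normW u : has_lbound [set `|h| | h in [set h : H | A h = A u]].
Proof. by exists 0 => _ [h _ <-]. Qed.

Lemma normW_le u : normW H f g mu (A u) <= `|u|.
Proof. by apply: ge_inf; [exact: has_lbound_normW|exists u]. Qed.

Lemma normW_ge0 u : 0 <= normW H f g mu (A u).
Proof.
by apply: lb_le_inf => [|_ [h _ <-]//]; exists `|u|, u.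
Qed.

(** Another preimage differs from [h] by an element of the kernel, which is orthogonal to [h]; by
    Pythagoras [h] has the least norm. *)
Lemma normW_perp h : kerA_perp H f g mu h -> `|h| <= normW H f g mu (A h).
Proof.
move=> hperp; apply: lb_le_inf => [|_ [u /= uh <-]]; first by exists `|h|, h.
have ker : kerA H f g mu (u - h).
  by rewrite /kerA /= (lin_opB A_lin) uh; apply/funext => x; rewrite subrr.
rewrite -[u](subrK h) addrC; apply: normr_le_orth; exact: hperp.
Qed.

End galerkin_stability.

Lemma Ck_on_le (R : realType) (V : normedModType R) (I : Type) (e : I -> V)
    (D : set V) (j k : nat) (f : V -> R) : (j <= k)%N -> Ck_on e D k f -> Ck_on e D j f.
Proof.
elim: k j f => [|k IH] [|j] f //=; first by move=> _ [].
rewrite ltnS => jk [cf df]; split => // i.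
by have [g /(IH _ _ jk) ? ?] := df i; exists g.
Qed.

(** Convergent sequences are bounded, which gives the pointwise bounds for the Banach-Steinhaus
    theorem. It is applied on the unit ball, and homogeneity gives the estimate for all vectors. *)
Lemma uniform_bound_cvg (R : realType) (V : completeNormedModType R)
    (W : normedModType R) (N0 : nat) (T : nat -> V -> W) :
  (forall N, (N0 <= N)%N -> linear (T N)) ->
  (forall N, (N0 <= N)%N -> exists C, forall u, `|T N u| <= C * `|u|) ->
  (forall u, cvgn (fun N => T N u)) ->
  exists2 M, 0 <= M & forall N, (N0 <= N)%N -> forall u, `|T N u| <= M * `|u|.
Proof.
move=> Tlin Tbnd Tcvg.
have [| |M MP] := @Banach_Steinhauss R V W [set T N | N in [set N | (N0 <= N)%N]] _ _ 1.
- move=> _ [N N0N <-]; split; last exact: Tlin.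
  move=> r; have [C CP] := Tbnd N N0N; exists (`|C| * r) => x xr.
  apply: le_trans (CP x) _; apply: (@le_trans _ _ (`|C| * `|x|)).
    by rewrite ler_wpM2r// ler_norm.
  by rewrite ler_wpM2l.
- move=> u; have [M [_ MP]] := cvg_seq_bounded (Tcvg u).
  exists (M + 1) => _ [N _ <-].
  by apply: (MP (M + 1)) => //; rewrite ltrDl.
exists `|M| => // N N0N u.
have [->|u0] := eqVneq u 0.
  have [C CP] := Tbnd N N0N.
  by have := CP 0; rewrite !normr0 !mulr0.
have nu : 0 < `|u| by rewrite normr_gt0.
have -> : u = `|u| *: (`|u|^-1 *: u) by rewrite scalerA divff ?scale1r// gt_eqF.
set w := _^-1 *: u.
have w1 : `|w| = 1 by rewrite normrZ normfV normr_id mulVf// gt_eqF.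
have TZ a x : T N (a *: x) = a *: T N x.
  have T0 : T N 0 = 0.
    have := Tlin N N0N (-1) 0 0.
    by rewrite scaler0 addr0 scaleN1r addNr.
  by have := Tlin N N0N a x 0; rewrite T0 !addr0.
rewrite TZ normrZ (normrZ _ w) normr_id w1 mulr1 mulrC ler_wpM2r//.
apply: le_trans (ler_norm M); apply: MP; last by rewrite w1.
by exists N.
Qed.

(** * Stability and error at a fixed number of centers *)

Section error.
Context (R : realType) (n m : nat) (Om : set 'rV[R]_n).
Hypothesis Om_compact : compact Om.
Hypothesis Om_neq0 : Om !=set0.
Context (K : 'rV[R]_n -> 'rV[R]_n -> R) (H : rkhs Om K).
Hypothesis K_sym : forall x y, Om x -> Om y -> K x y = K y x.
Hypothesis K_pos : strictly_positive_kernel Om K.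
Hypothesis K_cont : {within Om `*` Om, continuous (fun z => K z.1 z.2)}.
Context (kappa : R).
Hypothesis kappa_ge0 : 0 <= kappa.
Hypothesis K_diag : forall x, Om x -> K x x <= kappa ^+ 2.
Context (f : 'rV[R]_n -> 'cV[R]_n) (g : 'rV[R]_n -> 'M[R]_(n, m)).
Context (mu : 'rV[R]_n -> 'cV[R]_m).
Local Notation leb := (lebesgue_rV R n).
Local Notation A := (@Aop R n m Om K H f g mu).
Hypothesis A_lin : forall a (u v : H), A (a *: u + v) = (fun x => a * A u x + A v x).
Hypothesis W_embedded : embedW H f g mu.

Lemma Aop_inL2 u : inL2 Om (A u).
Proof. by apply: continuous_inL2 => //; apply: (proj1 W_embedded); exists u. Qed.

Lemma Aop_bounded : exists2 C, 0 <= C & forall u, normL2 Om (A u) <= C * `|u|.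
Proof.
have [_ [C CP]] := W_embedded.
(* The embedding constant comes without a sign, hence its absolute value. *)
exists (`|C| * Num.sqrt (fine (leb Om))); first by rewrite mulr_ge0// sqrtr_ge0.
move=> u; rewrite mulrAC.
apply: le_normL2 => //; [exact: Aop_inL2|move=> x Ox].
apply: le_trans (CP (A u) _ x Ox) _; first by exists u.
apply: (@le_trans _ _ (`|C| * normW H f g mu (A u))).
  by rewrite ler_wpM2r ?normW_ge0// ler_norm.
by rewrite ler_wpM2l// normW_le.
Qed.

Lemma normLoo_le (u : H) : (normLoo Om (ev u) <= (kappa * `|u|)%:E)%E.
Proof.
(* At exponent +oo the norm is an essential supremum if the whole space has positive measure, and 0
   otherwise. *)
rewrite /normLoo unlock; case: ifPn => _; last by rewrite lee_fin mulr_ge0.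
apply/ess_supP; apply: nearW => x /=; rewrite lee_fin /patch.
case: ifPn => [/set_mem Ox|_]; last by rewrite normr0 mulr_ge0.
exact: normr_ev_kappa.
Qed.

Section fixed_N.
Context (N : nat) (xi : 'I_N -> 'rV[R]_n) (beta : R).
Hypothesis xi_Om : forall i, Om (xi i).
Hypothesis xi_inj : injective xi.
Hypothesis HN_perp : HN H xi `<=` kerA_perp H f g mu.
Hypothesis beta_ge0 : 0 <= beta.
Hypothesis bernstein : forall w, YN H f g mu xi w ->
  normW H f g mu w <= beta * normL2 Om w.

Lemma gram_mx_definite (c : 'cV[R]_N) :
  (c^T *m gram_mx K xi *m c) ord0 ord0 = 0 -> c = 0.
Proof.
move=> c0; apply/eqP; apply: contraT => nc.
by have := K_pos xi_Om xi_inj nc; rewrite c0 ltxx.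
Qed.

Lemma gram_mx_unit : gram_mx K xi \in unitmx.
Proof. exact: posdef_unitmx gram_mx_definite. Qed.

(** Pairing a vanishing combination with each section puts its coefficient vector into the null
    space of the Gram matrix. *)
Lemma ksec_free (c : 'I_N -> R) :
  \sum_(i < N) c i *: ksec H (xi i) = 0 -> forall i, c i = 0.
Proof.
move=> c0 i; pose d : 'cV[R]_N := \col_j c j.
suff /matrixP/(_ i ord0) : d = 0 by rewrite !mxE.
apply: gram_mx_definite; rewrite -mulmxA.
have -> : gram_mx K xi *m d = 0; last by rewrite mulmx0 mxE.
apply/matrixP => k j; rewrite (ord1 j) !mxE.
rewrite -[RHS](dot0l (ksec H (xi k))) -c0 dot_suml.
by apply: eq_bigr => l _; rewrite dotZl dot_ksec// !mxE mulrC.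
Qed.

Lemma HN_stable h : HN H xi h -> `|h| <= beta * normL2 Om (A h).
Proof.
move=> Vh; apply: (@le_trans _ _ (normW H f g mu (A h))).
  exact/normW_perp/HN_perp.
apply: bernstein; exact: (lincomb_image A_lin Vh).
Qed.

Let GN_galerkin : GN H f g mu xi = galerkin Om A (fun i => ksec H (xi i)).
Proof. by []. Qed.

Lemma GN_bound y : inL2 Om y -> `|GN H f g mu xi y| <= beta * normL2 Om y.
Proof.
rewrite GN_galerkin.
exact: (galerkin_bound Om_compact A_lin Aop_inL2 ksec_free beta_ge0 HN_stable).
Qed.

Lemma GN_lin a y z : inL2 Om y -> inL2 Om z ->
  GN H f g mu xi (fun x => a * y x + z x) = a *: GN H f g mu xi y + GN H f g mu xi z.
Proof.
rewrite GN_galerkin.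
exact: (galerkin_lin Om_compact A_lin Aop_inL2 ksec_free beta_ge0 HN_stable).
Qed.

Lemma GN_A h : HN H xi h -> GN H f g mu xi (A h) = h.
Proof.
rewrite GN_galerkin.
exact: (galerkin_A Om_compact A_lin Aop_inL2 ksec_free beta_ge0 HN_stable).
Qed.

Lemma power_function_sup x : Om x ->
  power_function K xi x <= sup [set power_function K xi x | x in Om].
Proof.
move=> Ox; apply: ub_le_sup; last by exists x.
exists kappa => _ [y Oy <-].
exact: (power_function_le H K_sym kappa_ge0 K_diag xi_Om gram_mx_unit Oy).
Qed.

Lemma GN_error (v : H) p bd M : inL2 Om p ->
  (forall x, Om x -> ev v x = integral_op Om K p x) -> inL2 Om bd ->
  0 <= M -> (forall u, `|GN H f g mu xi (A u)| <= M * `|u|) ->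
  `|v - GN H f g mu xi bd| <= beta * normL2 Om (fun x => A v x - bd x)
    + (1 + M) * (normL2 Om p * (sup [set power_function K xi x | x in Om] *
        Num.sqrt (fine (leb Om)))).
Proof.
move=> p2 vp bd2 M0 GM.
set S := sup _.
have S0 : 0 <= S.
  have [x Ox] := Om_neq0.
  exact: le_trans (sqrtr_ge0 _) (power_function_sup Ox).
have Pv := HN_proj_power Om_compact K_sym K_cont kappa_ge0 K_diag xi_Om gram_mx_unit
  p2 vp power_function_sup S0.
set w := HN_proj _ _ in Pv.
have Gw : GN H f g mu xi (A w) = w by apply: GN_A; exact: HN_proj_in.
have GB y z : inL2 Om y -> inL2 Om z ->
    GN H f g mu xi (fun x => y x - z x) = GN H f g mu xi y - GN H f g mu xi z.
  move=> y2 z2; rewrite [RHS]addrC -scaleN1r -GN_lin//; congr GN.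
  by apply/funext => x; rewrite mulN1r addrC.
have Gvw : GN H f g mu xi (A (v - w)) = GN H f g mu xi (A v) - w.
  rewrite (lin_opB A_lin) (GB _ _ (Aop_inL2 v) (Aop_inL2 w)).
  by rewrite -[X in _ = _ - X]Gw.
(* With G for [GN]: as [G (A w) = w], the last bracket is [(v - w) - G (A (v - w))], the consistency
   error; the first term carries the noise. *)
have -> : v - GN H f g mu xi bd = GN H f g mu xi (fun x => A v x - bd x) +
    (v - w - (GN H f g mu xi (A v) - w)).
  rewrite [X in _ = X + _](GB _ _ (Aop_inL2 v) bd2).
  by rewrite (opprB _ w) subrKA [RHS]addrC subrKA.
apply: le_trans (ler_normD _ _) _; apply: lerD.
  by apply: GN_bound; apply: inL2B => //; exact: Aop_inL2.
apply: le_trans (ler_normB _ _) _.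
have GMvw := GM (v - w); rewrite Gvw in GMvw.
apply: (@le_trans _ _ ((1 + M) * `|v - w|)).
  by rewrite mulrDl mul1r lerD.
by rewrite ler_wpM2l// addr_ge0.
Qed.
End fixed_N.
End error.

(** * The error estimate with constants uniform in the number of centers and in the noise *)

Unset Implicit Arguments.
(** Point evaluation on [Om] has norm at most [kappa], so the comparison of the supremum norm with
    the norm of [H] carries this factor; it is the plain comparison when [kappa] is 1. *)
Theorem theorem3 (R : realType) (n m s : nat) (Om : set 'rV[R]_n)
  (Om_compact : compact Om) (Om_sc : simply_connected R Om)
  (Om_closure : closure (interior Om) = Om)
  (K : 'rV[R]_n -> 'rV[R]_n -> R)
  (K_sym : forall x y, Om x -> Om y -> K x y = K y x)
  (K_pos : strictly_positive_kernel Om K)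
  (kappa : R) (kappa_ge0 : 0 <= kappa)
  (K_diag : forall x, Om x -> K x x <= kappa ^+ 2)
  (s_gt0 : (1 <= s)%N) (K_smooth : Ck_kernel Om (2 * s) K)
  (H : rkhs Om K)
  (f : 'rV[R]_n -> 'cV[R]_n) (g : 'rV[R]_n -> 'M[R]_(n, m))
  (mu : 'rV[R]_n -> 'cV[R]_m)
  (W_embedded : embedW H f g mu)
  (N0 : nat) (xi : forall N, 'I_N -> 'rV[R]_n)
  (xi_Om : forall N, (N0 <= N)%N -> forall i, Om (xi N i))
  (xi_distinct : forall N, (N0 <= N)%N -> injective (xi N))
  (HN_perp : forall N, (N0 <= N)%N -> HN H (xi N) `<=` kerA_perp H f g mu)
  (b : 'rV[R]_n -> R) (b_W : rangeA H f g mu b)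
  (v : H) (v_sol : Aop f g mu v = b)
  (p : 'rV[R]_n -> R) (p_L2 : inL2 Om p)
  (v_Lp : forall x, Om x -> ev v x = integral_op Om K p x)
  (RI : nat -> R) (RI_gt0 : forall N, (N0 <= N)%N -> 0 < RI N)
  (RI_cvg : RI @ \oo --> 0)
  (bernstein : exists c : R, 0 < c /\
     forall N, (N0 <= N)%N -> forall w, YN H f g mu (xi N) w ->
       normW H f g mu w <= c * (RI N)^-1 * normL2 Om w)
  (convergent : galerkin_convergent H f g mu N0 xi) :
  exists CI C2 : R, [/\ 0 < CI, 0 < C2 &
    forall N, (N0 <= N)%N -> forall bd, inL2 Om bd ->
      let delta := normL2 Om (fun x => b x - bd x) in
      let vNd := GN H f g mu (xi N) bd in
      let sup_explicit :=
        sup [set Num.sqrt (K x x - ((kernel_col K (xi N) x)^T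
               *m invmx (gram_mx K (xi N)) *m kernel_col K (xi N) x) ord0 ord0)
            | x in Om] in
      let sup_power := sup [set power_function K (xi N) x | x in Om] in
      let bound := CI * (delta / RI N) + C2 * sup_explicit * normL2 Om p in
      [/\ (normLoo Om (ev (v - vNd)%R) <= (kappa * `|v - vNd|)%:E)%E,
          (normLoo Om (ev (v - vNd)%R) <= bound%:E)%E,
          `|v - vNd| <= bound
        & bound = CI * (delta / RI N) + C2 * sup_power * normL2 Om p]].
Proof.
have Om0 : Om !=set0 by case: Om_sc.
have K2 : Ck_kernel Om 2 K.
  by apply: Ck_on_le K_smooth; rewrite (leq_mul2l 2 1 s).
have K_cont : {within Om `*` Om, continuous (fun z => K z.1 z.2)} by case: K2.
have A_lin a (u w : H) : Aop f g mu (a *: u + w) =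
    (fun x => a * Aop f g mu u x + Aop f g mu w x).
  by rewrite (Aop_linear Om_closure K_sym K2).
have [CA CA0 AC] := Aop_bounded Om_compact W_embedded.
have A_L2 := Aop_inL2 Om_compact W_embedded.
have [c [c0 bern]] := bernstein.
have beta0 N : (N0 <= N)%N -> 0 <= c * (RI N)^-1.
  by move=> N0N; rewrite mulr_ge0 ?invr_ge0 ?ltW// RI_gt0.
(* The individual bounds [c / RI N * CA] may grow with [N]; pointwise convergence of the scheme on
   the range of A replaces them by a uniform one. *)
have [M M0 GM] : exists2 M : R, 0 <= M & forall N, (N0 <= N)%N -> forall u : H,
    `|GN H f g mu (xi N) (Aop f g mu u)| <= M * `|u|.
  apply: (@uniform_bound_cvg R H H N0
    (fun N u => GN H f g mu (xi N) (Aop f g mu u))) => [N N0N a u w|N N0N|u].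
  - rewrite A_lin.
    by apply: (GN_lin Om_compact K_pos A_lin W_embedded (xi_Om _ N0N)
      (xi_distinct _ N0N) (HN_perp _ N0N) (beta0 _ N0N) (bern _ N0N)).
  - exists (c * (RI N)^-1 * CA) => u.
    have Tu := (GN_bound Om_compact K_pos A_lin W_embedded (xi_Om _ N0N)
      (xi_distinct _ N0N) (HN_perp _ N0N) (beta0 _ N0N) (bern _ N0N) (A_L2 u)).
    apply: le_trans Tu _.
    by rewrite -[leRHS]mulrA ler_wpM2l ?beta0.
  - by apply: (cvgP (Apinv H f g mu (Aop f g mu u))); apply: convergent.2; exists u.
set q := Num.sqrt (fine (lebesgue_rV R n Om)).
have q0 : 0 <= q by exact: sqrtr_ge0.
(* The factor [1 + kappa] lets one estimate of [(1 + kappa) * |w|] control both [|w|] and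
   [kappa * |w|]. Using [q + 1] in place of [q] keeps the second constant positive without a lower
   bound on the measure of [Om]. *)
exists ((1 + kappa) * c), ((1 + kappa) * ((1 + M) * (q + 1))); split.
- by rewrite mulr_gt0// ltr_pwDl.
- by do ?apply: mulr_gt0; lra.
move=> N N0N bd bd2 /=.
set w := v - _.
set S := sup _; set d := normL2 Om (fun x => b x - bd x).
set bound := _ + _.
have S0 : 0 <= S.
  have [x Ox] := Om0; apply: le_trans (sqrtr_ge0 _) _.
  exact: (power_function_sup H K_sym K_pos kappa_ge0 K_diag (xi_Om _ N0N)
    (xi_distinct _ N0N) Ox).
have p0 : 0 <= normL2 Om p by exact: normL2_ge0.
have w_le : (1 + kappa) * `|w| <= bound.
  have := GN_error Om_compact Om0 K_sym K_pos K_cont kappa_ge0 K_diag A_lin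
    W_embedded (xi_Om _ N0N) (xi_distinct _ N0N) (HN_perp _ N0N) (beta0 _ N0N)
    (bern _ N0N) p_L2 v_Lp bd2 M0 (GM _ N0N).
  rewrite v_sol -/w -/d -/q => wE.
  apply: (@le_trans _ _ ((1 + kappa) * (c * (RI N)^-1 * d +
    (1 + M) * (normL2 Om p * (S * q))))).
    by rewrite ler_wpM2l// addr_ge0.
  have -> : bound = (1 + kappa) * (c * (RI N)^-1 * d +
      (1 + M) * (normL2 Om p * (S * (q + 1)))) by rewrite /bound; ring.
  rewrite ler_wpM2l ?addr_ge0// lerD2l !ler_wpM2l ?addr_ge0//.
  by rewrite lerDl.
have w1 : `|w| <= bound.
  by apply: le_trans w_le; rewrite ler_peMl// lerDl.
have wk : kappa * `|w| <= bound.
  by apply: le_trans w_le; rewrite ler_wpM2r// lerDr.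
have woo := normLoo_le kappa_ge0 K_diag w.
split => //.
by apply: le_trans woo _; rewrite lee_fin.
Qed.
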